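(* There exists a universal constant $C_0>0$ such that the following holds. Let $n,r\ge2$ be integers, let $\varepsilon\in(0,1)$, and let $T\in(\mathbb R^n)^{\otimes r}$ be a random tensor with independent (integrable, possibly unbounded) real entries such that, for some $L\ge1$, $\Pr(T_i\ne0)\le L\,n^{-1-\varepsilon}$ for all $i\in[n]^r$. Let $$C(r,\varepsilon):=\begin{cases}\dfrac{r^4}{\varepsilon}&\text{if } r\le\dfrac{\varepsilon\log n}{5\log\log n},\\[2mm]\dfrac{r^5}{\varepsilon^2}\log^2\dfrac r\varepsilon&\text{otherwise.}\end{cases}$$ Then $$\mathbb E\,\|T-\mathbb E T\|_{\mathrm{inj}}\le C_0\,C(r,\varepsilon)\,L\,\mathbb E\|T\|_\infty .$$ Moreover, for any $t>0$ and any $M\ge2\,\mathbb E\|T\|_\infty$, $$\Pr\Big(\|T-\mathbb E T\|_{\mathrm{inj}}>C_0\,L M\Big(C(r,\varepsilon)+\frac{r^3t}{\varepsilon}\Big)\Big)\le n^{-t}+\Pr\big(\|T\|_\infty>M\big).$$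
   Context: $[n]=\{1,\dots,n\}$; $\log$ is the natural logarithm (for $n=2$ the quantity $\frac{\varepsilon\log n}{5\log\log n}$ is negative, so the second case applies); $\mathbb E T$ is the entrywise expectation; $\|T\|_\infty=\max_{i\in[n]^r}|T_i|$. The injective norm of $T\in(\mathbb R^n)^{\otimes r}$ is $\|T\|_{\mathrm{inj}}=\max\{|\langle T,x_1\otimes\cdots\otimes x_r\rangle| : x_1,\dots,x_r\in\mathbb R^n,\ \|x_1\|_2=\dots=\|x_r\|_2=1\}$, where $\langle T,X\rangle=\sum_{i\in[n]^r}T_iX_i$. *)

(* Defs.v *)
From HB Require Import structures.
From mathcomp Require Import all_boot all_order all_algebra.
From mathcomp Require Import all_classical all_reals all_analysis.

Set Implicit Arguments.
Unset Strict Implicit.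
Unset Printing Implicit Defensive.

Import Order.TTheory GRing.Theory Num.Theory.
Import numFieldNormedType.Exports.
Local Open Scope classical_set_scope.
Local Open Scope ring_scope.

Section Tensors.
Context {R : realType}.

(* [n]^r, numbered from 0. *)
Definition tensor_index (n r : nat) : finType := {ffun 'I_r -> 'I_n}.

Definition tensor (n r : nat) : Type := tensor_index n r -> R.

Definition tensor_dot n r (T X : tensor n r) : R := \sum_i T i * X i.

Definition pure_tensor n r (x : 'I_r -> 'rV[R]_n) : tensor n r :=
  fun i => \prod_(k < r) x k ord0 (i k).

(* The library norm on 'rV[R]_n is the sup norm, so it cannot be used here. *)
Definition l2norm n (x : 'rV[R]_n) : R := Num.sqrt (\sum_(j < n) x ord0 j ^+ 2).

Definition inj_values n r (T : tensor n r) : set R :=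
  [set v | exists2 x : 'I_r -> 'rV[R]_n,
     (forall k, l2norm (x k) = 1) & v = `|tensor_dot T (pure_tensor x)| ].

(* For n >= 1 the supremum is attained: see inj_normP below. *)
Definition inj_norm n r (T : tensor n r) : R := sup (inj_values T).

Lemma inj_normP n r (T : tensor n r) : (0 < n)%N ->
  inj_values T (inj_norm T) /\ ubound (inj_values T) (inj_norm T).
Proof.
move=> n0.
pose X (v : 'rV[R]_(r * n)) (k : 'I_r) : 'rV[R]_n :=
  \row_j v ord0 (mxvec_index k j).
pose A : set 'rV[R]_(r * n) :=
  [set v | forall k, \sum_(j < n) v ord0 (mxvec_index k j) ^+ 2 = 1].
pose f v : R := `|tensor_dot T (pure_tensor (X v))|.
have l2X v k : l2norm (X v k) =
    Num.sqrt (\sum_(j < n) v ord0 (mxvec_index k j) ^+ 2).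
  by rewrite /l2norm; congr Num.sqrt; apply: eq_bigr => j _; rewrite mxE.
have AX v : A v -> forall k, l2norm (X v k) = 1.
  by move=> Av k; rewrite l2X Av sqrtr1.
have XA (x : 'I_r -> 'rV[R]_n) : (forall k, l2norm (x k) = 1) ->
    exists2 v, A v & X v = x.
  move=> x1; exists (mxvec (\matrix_(k, j) x k ord0 j)).
    move=> k; have := x1 k; rewrite /l2norm => /(congr1 (fun z => z ^+ 2)).
    rewrite sqr_sqrtr ?expr1n; last by apply: sumr_ge0 => j _; exact: sqr_ge0.
    by move=> <-; apply: eq_bigr => j _; rewrite mxvecE mxE.
  apply/funext => k; apply/rowP => j; rewrite mxE mxvecE mxE.
  by [].
have cA : compact A.
  apply: bounded_closed_compact.
    exists 1; split; first exact: num_real.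
    move=> M M1 v Av /=; apply: le_trans (ltW M1).
    rewrite (_ : `|v| = mx_norm v)// mx_normrE.
    apply: bigmax_le => // -[i l] _ /=; rewrite (ord1 i).
    case/mxvec_indexP: l => k j; rewrite -(@expr_le1 _ 2)// real_normK ?num_real//.
    rewrite -(Av k) (bigD1 j)//= lerDl; apply: sumr_ge0 => ? _; exact: sqr_ge0.
  rewrite (_ : A = \bigcap_(k in [set: 'I_r])
      ((fun v : 'rV[R]_(r * n) => \sum_(j < n) v ord0 (mxvec_index k j) ^+ 2)
        @^-1` [set 1])); last first.
    by apply/seteqP; split => v Av k; [move=> _; exact: Av | exact: Av].
  apply: closed_bigI => k _; apply: preimage_closed; last exact: closed_eq.
  move=> v _; move: v.
  apply: continuous_big => [|j _ v]; first exact: add_continuous.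
  apply: (continuous_comp (g := fun y : R => y ^+ 2)).
    exact: coord_continuous.
  exact: exprn_continuous.
have cf : continuous f.
  have cd : continuous (fun v => tensor_dot T (pure_tensor (X v))); last first.
    by move=> v; apply: continuous_comp; [exact: cd | exact: norm_continuous].
  rewrite /tensor_dot.
  apply: continuous_big => [|i _ v]; first exact: add_continuous.
  apply: (@continuousM _ _ (fun=> T i) (fun u => pure_tensor (X u) i)).
    exact: cst_continuous.
  have -> : (fun u => pure_tensor (X u) i) =
      (fun u => \prod_(k < r) u ord0 (mxvec_index k (i k))).
    by apply/funext => u; apply: eq_bigr => k _; rewrite mxE.
  move: v; apply: continuous_big => [|k _ v]; first exact: mul_continuous.
  exact: coord_continuous.
have A0 : A !=set0.
  have [|v Av _] := XA (fun=> delta_mx ord0 (Ordinal n0)); last by exists v.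
  move=> k; rewrite /l2norm (bigD1 (Ordinal n0))//= big1 => [|j jn0].
    by rewrite mxE !eqxx expr1n addr0 sqrtr1.
  by rewrite mxE (negbTE jn0) andbF expr0n.
have [c] := EVT_max_rV A0 cA (continuous_subspaceT cf).
rewrite inE => Ac cmax.
have vc : inj_values T (f c) by exists (X c) => //; exact: AX.
have ub : ubound (inj_values T) (f c).
  move=> _ [x /XA[v Av <-] ->]; apply: cmax; exact: mem_set.
suff -> : inj_norm T = f c by [].
apply/eqP; rewrite eq_le; apply/andP; split.
  by apply: ge_sup => //; exists (f c).
by apply: ub_le_sup => //; exists (f c).
Qed.

Definition tensor_sup_norm n r (T : tensor n r) : R :=
  \big[Num.max/0]_i `|T i|.

End Tensors.
Arguments tensor : clear implicits.

Section Random.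
Context {d : measure_display} {Omega : measurableType d} {R : realType}.
Variable P : probability Omega R.

Definition mutually_independent (I : finType) (X : I -> {RV P >-> R}) : Prop :=
  forall (J : {set I}) (A : I -> set R),
    (forall i, measurable (A i)) ->
    P (\bigcap_(i in [set` J]) (X i @^-1` A i)) =
    (\prod_(i in J) P (X i @^-1` A i))%E.

Variables n r : nat.

Definition sample (T : tensor_index n r -> {RV P >-> R}) (w : Omega) :
  tensor R n r := fun i => T i w.

(* For integrable entries 'E_P[T i] is finite and fine loses nothing. *)
Definition mean_tensor (T : tensor_index n r -> {RV P >-> R}) : tensor R n r :=
  fun i => fine 'E_P[T i].

Definition centered (T : tensor_index n r -> {RV P >-> R}) (w : Omega) :
  tensor R n r := fun i => sample T w i - mean_tensor T i.

End Random.

Definition Cconst (R : realType) (n r : nat) (eps : R) : R :=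
  if r%:R <= eps * ln n%:R / (5 * ln (ln n%:R)) then r%:R ^+ 4 / eps
  else r%:R ^+ 5 / eps ^+ 2 * ln (r%:R / eps) ^+ 2.

(* Main.v *)
Require Import Defs.
From HB Require Import structures.
From mathcomp Require Import all_boot all_order all_algebra.
From mathcomp Require Import all_classical all_reals all_analysis.
From mathcomp Require Import measurable_realfun ring lra zify.

(** A Kahn-Szemeredi type argument.  After rescaling by [M] and rounding, the
entries take finitely many values in [[-1, 1]], so that everything happens on a
finite product space; entries larger than [M] cost only [O(M)], since by
independence their total first moment is at most [2 E |T|_oo].

The injective norm is approximated by grid vectors [y_1, ..., y_r] of norm at
most 1.  Call an index [i] heavy when all [y_j(i_j)] are nonzero and
[prod_(l != j) y_l(i_l)^2 > rho ~ n^(-1 - eps/2)] for some [j].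
- On light indices the coefficient is at most [sqrt rho * min_j |y_j(i_j)|].
  Split them dyadically according to this minimum: at level [2^-s] only about
  [4^s] entries of each [y_j] matter, and the exponential moment of the centered
  sum beats the number of such vectors.
- On heavy indices centering is not needed: AM-GM bounds the coefficient by
  [(min_j y_j(i_j)^2 + sum_j prod_(l != j) y_l(i_l)^2) / 2].  The second part is
  controlled because every fiber has [O((r + t) / eps)] nonzero entries.  For the
  first, with high probability the number of nonzero entries at the heavy indices
  of every grid vector is at most [K] times the size of its support; applying this
  to the truncations [y 1_{|y| > a}] and integrating over [a] gives
  [K sum_j |y_j|^2 <= K r]. *)

Set Implicit Arguments.
Unset Strict Implicit.
Unset Printing Implicit Defensive.
Import Order.TTheory GRing.Theory Num.Theory.
Import numFieldNormedType.Exports.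
Local Open Scope ring_scope.

(** * Exponential moments on a finite product space *)

Section ProductProbability.
Context {R : realType} (I V : finType) (mu : I -> V -> R).

Definition prod_weight (f : {ffun I -> V}) : R := \prod_i mu i (f i).

Definition prod_prob (E : pred {ffun I -> V}) : R := \sum_(f | E f) prod_weight f.

Lemma sum_prod_weight (phi : I -> V -> R) :
  \sum_f prod_weight f * \prod_i phi i (f i) = \prod_i \sum_v mu i v * phi i v.
Proof.
by rewrite bigA_distr_bigA; apply: eq_bigr => f _; rewrite -big_split.
Qed.

Hypothesis mu_ge0 : forall i v, 0 <= mu i v.

Lemma prod_weight_ge0 f : 0 <= prod_weight f.
Proof. by apply: prodr_ge0. Qed.

Lemma prod_prob_le (E1 E2 : pred {ffun I -> V}) :
  (forall f, E1 f -> E2 f) -> prod_prob E1 <= prod_prob E2.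
Proof.
move=> E12; rewrite /prod_prob big_mkcond [leRHS]big_mkcond /=.
apply: ler_sum => f _; case: ifPn => [/E12 -> //|_].
by case: ifPn => // _; exact: prod_weight_ge0.
Qed.

Lemma prod_prob_or (E1 E2 : pred {ffun I -> V}) :
  prod_prob (fun f => E1 f || E2 f) <= prod_prob E1 + prod_prob E2.
Proof.
rewrite /prod_prob big_mkcond (big_mkcond E1) (big_mkcond E2) -big_split /=.
apply: ler_sum => f _; have := prod_weight_ge0 f.
by case: (E1 f); case: (E2 f) => /=; lra.
Qed.

Lemma prod_prob_exists (J : finType) (E : J -> pred {ffun I -> V}) :
  prod_prob (fun f => [exists j, E j f]) <= \sum_j prod_prob (E j).
Proof.
rewrite /prod_prob; under [leRHS]eq_bigr do rewrite big_mkcond.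
rewrite exchange_big /= big_mkcond; apply: ler_sum => f _.
have sge0 (A : pred J) : 0 <= \sum_(j | A j) (if E j f then prod_weight f else 0).
  by apply: sumr_ge0 => j _; case: ifP => // _; exact: prod_weight_ge0.
case: ifPn => // /existsP[j Ej].
by rewrite (bigD1 j) //= Ej lerDl.
Qed.

(** The indicator of the event is at most [expR (\sum_i phi i (f i) - u)], whose expectation factors
    over the coordinates. *)
Lemma exp_markov (phi : I -> V -> R) (b : I -> R) (u : R) :
  (forall i, \sum_v mu i v * expR (phi i v) <= expR (b i)) ->
  prod_prob (fun f => u < \sum_i phi i (f i)) <= expR (\sum_i b i - u).
Proof.
move=> mgf; rewrite expRD.
apply: (@le_trans _ _
  (\sum_f prod_weight f * \prod_i expR (phi i (f i)) * expR (- u))).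
  rewrite /prod_prob big_mkcond; apply: ler_sum => f _.
  case: ifPn => [uf|_]; last first.
    by rewrite !mulr_ge0 ?prod_weight_ge0 ?expR_ge0// prodr_ge0// => i _; exact: expR_ge0.
  rewrite -mulrA ler_peMr ?prod_weight_ge0// -expR_sum -expRD -expR0 ler_expR; lra.
rewrite -mulr_suml (sum_prod_weight (fun i v => expR (phi i v))) ler_wpM2r ?expR_ge0//
  expR_sum.
apply: ler_prod => i _; rewrite mgf andbT; apply: sumr_ge0 => v _.
by rewrite mulr_ge0 ?expR_ge0.
Qed.

End ProductProbability.

Section MomentGeneratingFunctions.
Context {R : realType}.

(** Invert [1 - y <= expR (- y)] and use [(1 - y) * (1 + y + 2 * y ^+ 2) = 1 + y ^+ 2 * (1 - 2 * y)
    >= 1]. *)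
Lemma expR_le_quadratic (y : R) : y <= 1 / 2 -> expR y <= 1 + y + 2 * y ^+ 2.
Proof.
move=> y2; have ey := expR_ge1Dx (- y).
rewrite -[y in expR y]opprK expRN -[leRHS]invrK.
have q0 : 0 < 1 + y + 2 * y ^+ 2 by nra.
rewrite lef_pV2 ?posrE ?expR_gt0 ?invr_gt0//.
apply: le_trans ey; rewrite -div1r ler_pdivrMr//; nra.
Qed.

Context (V : finType) (mu : V -> R) (val : V -> R) (p : R).
Hypothesis mu_ge0 : forall v, 0 <= mu v.
Hypothesis mu_sum : \sum_v mu v = 1.
Hypothesis mu_p : \sum_(v | val v != 0) mu v <= p.

Lemma mgf_nonzero (a : R) : 0 <= a ->
  \sum_v mu v * expR (a * (val v != 0)%:R) <= expR (p * expR a).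
Proof.
move=> a0; apply: le_trans (expR_ge1Dx _).
rewrite (eq_bigr (fun v => mu v + (if val v != 0 then mu v else 0) * (expR a - 1)));
  last first.
  by move=> v _; case: (val v != 0); rewrite ?mulr1 ?mulr0 ?expR0; ring.
rewrite big_split /= mu_sum lerD2l -mulr_suml -big_mkcond.
have p0 : 0 <= \sum_(v | val v != 0) mu v by apply: sumr_ge0.
have ea : 1 <= expR a by rewrite -expR0 ler_expR.
apply: (@le_trans _ _ (p * (expR a - 1))); first by rewrite ler_wpM2r// subr_ge0.
by rewrite ler_wpM2l ?gerBl// (le_trans p0).
Qed.

Hypothesis val_le1 : forall v, `|val v| <= 1.

Definition fmean : R := \sum_v mu v * val v.

Lemma fmean_le : `|fmean| <= p.
Proof.
apply: le_trans mu_p; rewrite /fmean.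
apply: le_trans (ler_norm_sum _ _ _) _; rewrite [leRHS]big_mkcond.
apply: ler_sum => v _; rewrite normrM (ger0_norm (mu_ge0 v)).
by case: eqP => [->|_] /=; rewrite ?normr0 ?mulr0// ler_piMr.
Qed.

Lemma fmean_le1 : `|fmean| <= 1.
Proof.
rewrite -mu_sum; apply: le_trans (ler_norm_sum _ _ _) _.
by apply: ler_sum => v _; rewrite normrM (ger0_norm (mu_ge0 v)) ler_piMr.
Qed.

(** Since [|val v - fmean| <= 2], the exponent is at most [1 / 2] and the quadratic bound applies.
    The linear term averages to zero and the variance is at most [p]. *)
Lemma mgf_centered (c : R) : `|c| <= 1 / 4 ->
  \sum_v mu v * expR (c * (val v - fmean)) <= expR (2 * c ^+ 2 * p).
Proof.
move=> c4; apply: le_trans (expR_ge1Dx _).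
apply: (@le_trans _ _ (\sum_v (mu v + (mu v * val v) * c - mu v * (c * fmean)
   + 2 * c ^+ 2 * (mu v * val v ^+ 2 - 2 * fmean * (mu v * val v) + fmean ^+ 2 * mu v)))).
  apply: ler_sum => v _.
  rewrite [leRHS](_ : _ = mu v * (1 + c * (val v - fmean) + 2 * (c * (val v - fmean))
    ^+ 2)).
    rewrite ler_wpM2l//; apply: expR_le_quadratic.
    apply: le_trans (ler_norm _) _; rewrite normrM.
    have := ler_normB (val v) fmean; have := val_le1 v; have := fmean_le1.
    by have := normr_ge0 c; nra.
  by ring.
rewrite !big_split /= -mulr_suml sumrN -!mulr_suml -mulr_sumr !big_split /= sumrN
  -!mulr_sumr.
rewrite -/fmean mu_sum.
have : \sum_v mu v * val v ^+ 2 <= p.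
  apply: le_trans mu_p; rewrite [leRHS]big_mkcond; apply: ler_sum => v _.
  case: eqP => [->|_] /=; first by rewrite expr0n mulr0.
  by rewrite ler_piMr// -real_normK ?num_real// expr_le1.
move: (\sum_v _) => q qp.
have c2 := sqr_ge0 c; have m2 := sqr_ge0 fmean.
nra.
Qed.

End MomentGeneratingFunctions.

(** * Grid vectors: light and heavy indices *)

Section Grid.
Context {R : realType} (m : nat).
Hypothesis m_gt0 : (0 < m)%N.

(** Grid points are numbered [0] to [2 * m], with zero at [m]. One of the two truncated differences
    always vanishes, so the sum is the distance to zero. *)
Definition mag (g : 'I_(2 * m).+1) : nat := (g - m + (m - g))%N.

Definition gval (g : 'I_(2 * m).+1) : R := (g%:R - m%:R) / m%:R.

Definition gzero : 'I_(2 * m).+1 := inord m.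

Lemma mR_gt0 : 0 < m%:R :> R. Proof. by rewrite ltr0n. Qed.

Lemma gzeroE : gzero = m :> nat. Proof. by rewrite inordK//; lia. Qed.

Lemma mag_gzero : mag gzero = 0%N. Proof. by rewrite /mag gzeroE; lia. Qed.

Lemma mag_le g : (mag g <= m)%N. Proof. by have := ltn_ord g; rewrite /mag; lia. Qed.

Lemma norm_gval g : `|gval g| = (mag g)%:R / m%:R.
Proof.
rewrite /gval /mag normrM normfV [`|m%:R|]ger0_norm//; congr (_ / _).
case: (leqP m g) => mg.
  by rewrite ger0_norm ?subr_ge0 ?ler_nat// natrD natrB// (eqP mg) addr0.
rewrite ltr0_norm ?subr_lt0 ?ltr_nat// natrD (natrB _ (ltnW mg)) opprB.
by rewrite (eqP (ltnW mg)) add0r.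
Qed.

Lemma gval_sqr g : gval g ^+ 2 = (mag g ^ 2)%:R / m%:R ^+ 2.
Proof. by rewrite -[LHS]real_normK ?num_real// norm_gval expr_div_n natrX. Qed.

Lemma gval_le1 g : `|gval g| <= 1.
Proof. by rewrite norm_gval ler_pdivrMr ?mR_gt0// mul1r ler_nat mag_le. Qed.

Lemma gval_eq0 g : (gval g == 0) = (mag g == 0%N).
Proof.
by rewrite -normr_eq0 norm_gval mulf_eq0 invr_eq0 (gt_eqF mR_gt0) orbF pnatr_eq0.
Qed.

(** Rounding towards zero, so that norms never increase. [Num.truncn] vanishes on negative reals,
    hence at most one of the two terms is nonzero. *)
Definition round0 (x : R) : 'I_(2 * m).+1 :=
  inord (m + Num.truncn (m%:R * x) - Num.truncn (- (m%:R * x))).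

Lemma round0_mono (x y : R) : `|x| <= 1 -> `|y| <= 1 -> x <= y ->
  (round0 x <= round0 y)%N.
Proof.
move=> x1 y1 xy; have m0 := mR_gt0.
have bnd (z : R) : `|z| <= 1 -> (Num.truncn (m%:R * z) <= m)%N.
  move=> /ler_normlP[_ z1]; rewrite truncn_le_nat -natr1; nra.
rewrite /round0 !inordK; do ?[by have := bnd x x1; have := bnd y y1; lia].
by apply: leq_sub; rewrite ?leq_add2l; apply: le_truncn; nra.
Qed.

Lemma round0_spec (x : R) : `|x| <= 1 ->
  `|gval (round0 x)| <= `|x| /\ `|x - gval (round0 x)| <= m%:R^-1.
Proof.
move=> x1; have m0 := mR_gt0.
pose a := Num.truncn (m%:R * x); pose b := Num.truncn (- (m%:R * x)).
have am : (a <= m)%N by rewrite truncn_le_nat -natr1; move/ler_normlP: x1 => [_ x1]; nra.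
have bm : (b <= m)%N by rewrite truncn_le_nat -natr1; move/ler_normlP: x1 => [x1 _]; nra.
have gE : gval (round0 x) = (a%:R - b%:R) / m%:R.
  rewrite /gval /round0 inordK -/a -/b; last by lia.
  by rewrite natrB ?natrD; [congr (_ / _); ring | lia].
have xE : x = (m%:R * x) / m%:R by rewrite mulrC mulKf ?gt_eqF.
suff [k1 k2] : `|a%:R - b%:R| <= `|m%:R * x| /\ `|m%:R * x - (a%:R - b%:R)| <= 1.
  rewrite gE [x in X in _ /\ X]xE -mulrBl !normrM !normfV [`|m%:R|]ger0_norm ?(ltW m0)//.
  split; last by rewrite ler_piMl ?invr_ge0 ?(ltW m0).
  by rewrite ler_pdivrMr// mulrC; move: k1; rewrite normrM [`|m%:R|]ger0_norm ?(ltW m0).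
case: (leP 0 x) => x0.
  have mx0 : 0 <= m%:R * x by rewrite mulr_ge0// ltW.
  have -> : b = 0%N by apply/eqP; rewrite -leqn0 truncn_le_nat; nra.
  have /andP[] := truncn_itv mx0; rewrite -/a -natr1 subr0 => a1 a2.
  by split; [rewrite !ger0_norm | apply/ler_normlP; split; lra].
have mx0 : 0 <= - (m%:R * x) by nra.
have -> : a = 0%N by apply/eqP; rewrite -leqn0 truncn_le_nat; nra.
have /andP[] := truncn_itv mx0; rewrite -/b -natr1 sub0r => a1 a2.
split; last by apply/ler_normlP; split; lra.
by rewrite normrN -[`|m%:R * x|]normrN !ger0_norm.
Qed.

End Grid.

Section GridTuples.
Context {R : realType} (n r m : nat).
Hypotheses (m_gt0 : (0 < m)%N) (r_gt0 : (0 < r)%N).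

Definition grid : finType := {ffun 'I_r * 'I_n -> 'I_(2 * m).+1}.

Implicit Types (z : grid) (i : tensor_index n r) (j : 'I_r) (c : pred nat).

Definition in_ball z := [forall j, (\sum_(v < n) mag (z (j, v)) ^ 2 <= m ^ 2)%N].

Definition supp z : {set 'I_r * 'I_n} := [set q | mag (z q) != 0%N].

Definition restrict (c : pred nat) z : grid :=
  [ffun q => if c (mag (z q)) then z q else gzero m].

Definition coef z i : R := \prod_j gval (z (j, i j)).

Definition cofac z i j : R := \prod_(l | l != j) gval (z (l, i l)) ^+ 2.

(** All magnitudes are at most [m], so the default [m] is neutral for the minimum. *)
Definition minmag z i : nat := \big[minn/m]_j mag (z (j, i j)).

Definition heavy (rho : R) z i :=
  (0 < minmag z i)%N && [exists j, rho < cofac z i j].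

Lemma mag_restrict c z q :
  mag (restrict c z q) = if c (mag (z q)) then mag (z q) else 0%N.
Proof. by rewrite ffunE; case: ifP => // _; rewrite mag_gzero. Qed.

Lemma in_ball_restrict c z : in_ball z -> in_ball (restrict c z).
Proof.
move=> /forallP bz; apply/forallP => j; apply: leq_trans (bz j).
by apply: leq_sum => v _; rewrite mag_restrict; case: ifP.
Qed.

Lemma restrict_id c z i : (forall j, c (mag (z (j, i j)))) ->
  forall j, restrict c z (j, i j) = z (j, i j).
Proof. by move=> cz j; rewrite ffunE cz. Qed.

Lemma coef_ext z1 z2 i : (forall j, z1 (j, i j) = z2 (j, i j)) ->
  coef z1 i = coef z2 i.
Proof. by move=> e; apply: eq_bigr => j _; rewrite e. Qed.

Lemma minmag_ext z1 z2 i : (forall j, z1 (j, i j) = z2 (j, i j)) ->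
  minmag z1 i = minmag z2 i.
Proof. by move=> e; apply: eq_bigr => j _; rewrite e. Qed.

Lemma heavy_ext rho z1 z2 i : (forall j, z1 (j, i j) = z2 (j, i j)) ->
  heavy rho z1 i = heavy rho z2 i.
Proof.
move=> e; rewrite /heavy (minmag_ext e); congr andb.
by apply: eq_existsb => j; congr (_ < _); apply: eq_bigr => l _; rewrite e.
Qed.

Lemma ltn_minmag a z i :
  (a < minmag z i)%N = (a < m)%N && [forall j, (a < mag (z (j, i j)))%N].
Proof.
rewrite (_ : [forall j, _] = \big[andb/true]_j (a < mag (z (j, i j)))%N); last first.
  by rewrite big_andE; apply: eq_forallb.
rewrite /minmag; elim/big_rec2: _ => [|j b k _ IH]; first by rewrite andbT.
by rewrite leq_min IH andbCA.
Qed.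

Lemma minmag_le z i j : (minmag z i <= mag (z (j, i j)))%N.
Proof.
rewrite leqNgt; apply/negP; rewrite ltn_minmag => /andP[_ /forallP/(_ j)].
by rewrite ltnn.
Qed.

Lemma minmag_lem z i : (minmag z i <= m)%N.
Proof. by rewrite leqNgt ltn_minmag ltnn. Qed.

Lemma minmag_attained z i : exists j, minmag z i = mag (z (j, i j)).
Proof.
suff [j mj] : exists j, (mag (z (j, i j)) <= minmag z i)%N.
  by exists j; apply/eqP; rewrite eqn_leq minmag_le.
have := ltnn (minmag z i); rewrite [X in X = _]ltn_minmag.
case: (ltnP (minmag z i) m) => [_|mm _] /=.
  by move/negbT; rewrite negb_forall => /existsP[j]; rewrite -leqNgt; exists j.
by exists (Ordinal r_gt0); apply: leq_trans mm; exact: mag_le.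
Qed.

Lemma coef_eq0 z i : minmag z i = 0%N -> coef z i = 0.
Proof.
have [j ->] := minmag_attained z i => m0.
by apply/eqP/prodf_eq0; exists j => //; rewrite gval_eq0// m0.
Qed.

Lemma cofac_ge0 z i j : 0 <= cofac z i j.
Proof. by apply: prodr_ge0 => l _; exact: sqr_ge0. Qed.

Lemma coef_sqr z i j : coef z i ^+ 2 = gval (z (j, i j)) ^+ 2 * cofac z i j.
Proof.
by rewrite /coef (bigD1 j)//= exprMn; congr (_ * _); rewrite -prodrXl.
Qed.

(* AM-GM, singling out the coordinate of least magnitude. *)
Lemma coef_amgm z i :
  `|coef z i| <= (((minmag z i)%:R / m%:R) ^+ 2 + \sum_j cofac z i j) / 2.
Proof.
have [j mj] := minmag_attained z i.
have cs : cofac z i j <= \sum_l cofac z i l.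
  by rewrite (bigD1 j)//= lerDl; apply: sumr_ge0 => l _; exact: cofac_ge0.
apply: (@le_trans _ _ (((minmag z i)%:R / m%:R) ^+ 2 / 2 + cofac z i j / 2)); last by lra.
have c2 := coef_sqr z i j; rewrite -mulrDl.
rewrite mj -norm_gval real_normK ?num_real//; move: (gval _ ^+ 2) c2 (sqr_ge0 (gval (z
  (j, i j)) : R)) => a c2 a0.
have b0 := cofac_ge0 z i j.
rewrite -ler_sqr ?nnegrE ?normr_ge0 ?divr_ge0 ?addr_ge0//.
rewrite real_normK ?num_real// c2 expr_div_n.
move: (cofac z i j) => b; have := sqr_ge0 (a - b); nra.
Qed.

Lemma gval_ball z j : in_ball z -> \sum_(v < n) gval (z (j, v)) ^+ 2 <= 1 :> R.
Proof.
move=> /forallP/(_ j) bz; have m0 := mR_gt0 (R := R) m_gt0.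
under eq_bigr do rewrite gval_sqr.
by rewrite -mulr_suml -natr_sum ler_pdivrMr ?exprn_gt0// mul1r -natrX ler_nat.
Qed.

Lemma coef_sqr_sum z : in_ball z -> \sum_i coef z i ^+ 2 <= 1.
Proof.
move=> bz; under eq_bigr do rewrite -prodrXl.
rewrite -(bigA_distr_bigA (fun j v => gval (z (j, v)) ^+ 2)) /=.
apply: prodr_ile1 => j _; rewrite gval_ball ?andbT//.
by apply: sumr_ge0 => v _; exact: sqr_ge0.
Qed.

(** [F] turns the constraint [i j = v] into a factor, so that the whole sum splits into a product of
    squared norms, each at most 1. *)
Lemma cofac_sum z j (v : 'I_n) : in_ball z ->
  \sum_(i : tensor_index n r | i j == v) cofac z i j <= 1.
Proof.
move=> bz; pose F l u : R := if l == j then (u == v)%:R else gval (z (l, u)) ^+ 2.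
apply: (@le_trans _ _ (\sum_(i : tensor_index n r) \prod_l F l (i l))).
  rewrite big_mkcond; apply: ler_sum => i _; rewrite (bigD1 j)//= {1}/F eqxx.
  case: ifPn => [ij|_]; last by rewrite mul0r.
  rewrite mul1r le_eqVlt; apply/orP; left; apply/eqP.
  by apply: eq_bigr => l lj; rewrite /F (negbTE lj).
rewrite -(bigA_distr_bigA F) /=.
apply: prodr_ile1 => l _; rewrite /F; case: eqP => _.
  rewrite (bigD1 v)//= eqxx big1 ?addr0 ?lexx ?ler01// => u /negbTE -> //.
rewrite gval_ball ?andbT//; by apply: sumr_ge0 => u _; exact: sqr_ge0.
Qed.

(** Charge a heavy [i] to a position [(j, i j)] with [cofac z i j > rho]. It lies in the support,
    and by [cofac_sum] it is charged at most [1 / rho] times. *)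
Lemma card_heavy rho z : 0 < rho -> in_ball z ->
  \sum_(i | heavy rho z i) 1 <= #|supp z|%:R / rho.
Proof.
move=> rho0 bz.
apply: (@le_trans _ _ (\sum_(q in supp z) \sum_(i : tensor_index n r | i q.1 == q.2)
   cofac z i q.1 / rho)); last first.
  rewrite -sum1_card natr_sum mulr_suml; apply: ler_sum => -[j v] _ /=.
  by rewrite -mulr_suml ler_wpM2r ?invr_ge0 ?(ltW rho0)// cofac_sum.
under [leRHS]eq_bigr do rewrite big_mkcond /=.
rewrite [leRHS]exchange_big big_mkcond /=; apply: ler_sum => i _.
have t0 q : 0 <= (if i q.1 == q.2 then cofac z i q.1 / rho else 0).
  by case: ifP => // _; rewrite divr_ge0 ?cofac_ge0 ?(ltW rho0).
case: ifPn => [/andP[mi /existsP[j hj]]|_]; last exact: sumr_ge0.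
rewrite (bigD1 (j, i j)) /=; last by rewrite inE -lt0n (leq_trans mi)// minmag_le.
rewrite eqxx -[leLHS]addr0; apply: lerD; last exact: sumr_ge0.
by rewrite ler_pdivlMr// mul1r (ltW hj).
Qed.

Lemma sqr_layer_cake k : (k <= m)%N ->
  (k ^ 2 = \sum_(a < m) (2 * a + 1) * (a < k))%N.
Proof.
move=> km; rewrite -(subnKC km) big_split_ord /=.
rewrite [X in (_ + X)%N]big1 ?addn0 => [|a _]; last by rewrite ltnNge leq_addr muln0.
under eq_bigr => a _ do rewrite ltn_ord muln1.
by elim: k {km} => [|k IH]; rewrite ?big_ord0// big_ord_recr /= -IH; lia.
Qed.

Lemma heavy_restrict rho z i a : heavy rho z i -> (a < minmag z i)%N ->
  heavy rho (restrict (ltn a) z) i.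
Proof.
move=> hz; rewrite ltn_minmag => /andP[_ /forallP az].
by rewrite (heavy_ext rho (restrict_id (c := ltn a) az)).
Qed.

(* Layer cake over the level sets of the minimal magnitude. *)
Lemma heavy_minmag_sum rho (b : tensor_index n r -> R) (K : R) z :
  (forall i, 0 <= b i) ->
  (forall z', in_ball z' -> \sum_(i | heavy rho z' i) b i <= K * #|supp z'|%:R) ->
  0 <= K -> in_ball z ->
  \sum_(i | heavy rho z i) b i * ((minmag z i)%:R / m%:R) ^+ 2 <= K * r%:R.
Proof.
move=> b0 bK K0 bz; have m0 := mR_gt0 (R := R) m_gt0.
have m2 : 0 < m%:R ^+ 2 :> R by rewrite exprn_gt0.
under eq_bigr do rewrite expr_div_n mulrA -natrX sqr_layer_cake ?minmag_lem//.
rewrite -mulr_suml ler_pdivrMr//.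
under eq_bigr do rewrite natr_sum mulr_sumr.
rewrite exchange_big /=.
apply: (@le_trans _ _ (\sum_(a < m) (2 * a + 1)%:R * (K * #|supp (restrict (ltn a)
  z)|%:R))).
  apply: ler_sum => a _; under eq_bigr do rewrite natrM mulrCA.
  rewrite -mulr_sumr ler_wpM2l//.
  apply: le_trans (bK _ (in_ball_restrict (ltn a) bz)).
  rewrite big_mkcond [leRHS]big_mkcond; apply: ler_sum => i _.
  case: ifPn => hz; last by case: ifPn.
  case: (ltnP a (minmag z i)) => [az|_].
    by rewrite heavy_restrict// mulr1.
  by rewrite mulr0; case: ifP.
have suppE a : #|supp (restrict (ltn a) z)| = (\sum_q (a < mag (z q))%N)%N.
  rewrite -sum1_card big_mkcond /=; apply: eq_bigr => q _.
  by rewrite inE mag_restrict /=; case: ltnP => // az; rewrite -lt0n (leq_ltn_trans _ az).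
under eq_bigr do rewrite suppE mulrCA -natrM big_distrr /=.
(* The odd weights recombine the support sizes into [\sum_q mag (z q) ^ 2], at most [m ^ 2] for each
   of the [r] vectors. *)
rewrite -mulr_sumr -mulrA ler_wpM2l// -natr_sum -natrX -natrM ler_nat exchange_big /=.
under eq_bigr do rewrite -sqr_layer_cake ?mag_le//.
rewrite (eq_bigr (fun q => mag (z (q.1, q.2)) ^ 2)%N) => [|[] //].
rewrite -(pair_bigA _ (fun j v => mag (z (j, v)) ^ 2)%N) /=.
rewrite -[X in (_ <= X * _)%N]card_ord -sum_nat_const; apply: leq_sum => j _.
by move/forallP: bz; apply.
Qed.

End GridTuples.

(** * Dyadic levels of the light part and the deterministic estimate *)

Section LightHeavy.
Context {R : realType} (n r m : nat).
Hypotheses (m_gt0 : (0 < m)%N) (r_gt0 : (0 < r)%N) (n_gt0 : (0 < n)%N).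
Implicit Types (z : grid n r m) (i : tensor_index n r) (j : 'I_r).

(** A representative of the fiber through [i] in direction [j]: two indices have the same image
    exactly when they agree outside coordinate [j]. *)
Definition reset j i : tensor_index n r :=
  [ffun l => if l == j then Ordinal n_gt0 else i l].

Lemma card_fiber j i' : (#|[pred i | reset j i == i']| <= n)%N.
Proof.
rewrite -[leqRHS]card_ord.
rewrite -(card_in_imset (f := fun i : tensor_index n r => i j) (D := [pred i | reset j
  i == i'])).
  exact: max_card.
move=> i1 i2; rewrite !inE => /eqP <- /eqP e ij; apply/ffunP => l.
by have /ffunP/(_ l) := e; rewrite !ffunE; case: eqP => [->|_ ->].
Qed.

(** [cofac z i j] is constant on the fibers of [reset j]. Bound each fiber sum of [b] by [k], then
    sum the cofactors over representatives. *)
Lemma cofac_fiber_sum (b : tensor_index n r -> R) (k : R) z j :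
  0 <= k -> (forall i', \sum_(i | reset j i == i') b i <= k) -> in_ball z ->
  \sum_i b i * cofac z i j <= k.
Proof.
move=> k0 bk bz; rewrite (partition_big (reset j) (fun i' => i' j == Ordinal n_gt0))
  /=; last first.
  by move=> i _; rewrite ffunE eqxx.
apply: (@le_trans _ _ (\sum_(i' : tensor_index n r | i' j == Ordinal n_gt0) k * cofac z
  i' j)).
  apply: ler_sum => i' _.
  rewrite (eq_bigr (fun i => b i * cofac z i' j)); last first.
    move=> i /eqP <-; congr (_ * _); apply: eq_bigr => l lj.
    by rewrite ffunE (negbTE lj).
  by rewrite -mulr_suml ler_wpM2r ?cofac_ge0.
by rewrite -mulr_sumr ler_piMr// cofac_sum.
Qed.

(** If [minmag z i = 0] the quotient is [0] and so is the level, which is harmless as the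
    coefficient vanishes. Level [S] collects all the smallest magnitudes. *)
Definition level (S : nat) z i : nat := minn S (trunc_log 2 (m %/ minmag z i)).

Definition light (rho : R) (S : nat) z (s : nat) i : R :=
  if ~~ heavy rho z i && (level S z i == s) then coef z i else 0.

(** Below level [S], an index of level [s] with nonzero coefficient only involves magnitudes above
    [m / 2 ^ s.+1]. Level [S] has no such lower bound. *)
Definition kept (S s a : nat) : bool := (s == S) || (m < a * 2 ^ s.+1)%N.

(** Where [i] is not heavy and [minmag] is positive, all cofactors are at most [tau ^+ 2]. Apply
    this at the coordinate of least magnitude, whose value is at most [2 ^- s]. *)
Lemma light_le (tau : R) S z s i : 0 <= tau ->
  `|light (tau ^+ 2) S z s i| <= tau / 2 ^+ s.
Proof.
move=> tau0; have t0 : 0 <= tau / 2 ^+ s by rewrite divr_ge0 ?exprn_ge0.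
rewrite /light; case: ifPn => [/andP[nh /eqP ls]|_]; last by rewrite normr0.
case: (posnP (minmag z i)) => [z0|zp]; first by rewrite (coef_eq0 m_gt0 r_gt0) ?normr0.
have [j mj] := minmag_attained m_gt0 r_gt0 z i.
move: nh; rewrite negb_and zp /= negb_exists => /forallP/(_ j); rewrite -leNgt => cj.
rewrite -ler_sqr ?nnegrE// real_normK ?num_real// (coef_sqr z i j) [(tau / _) ^+
  2]expr_div_n mulrC.
rewrite ler_pM ?cofac_ge0 ?sqr_ge0//.
have mz : (2 ^ s * minmag z i <= m)%N.
  rewrite -leq_divRL//; apply: (@leq_trans (2 ^ trunc_log 2 (m %/ minmag z i))).
    by rewrite leq_pexp2l// -ls geq_minr.
  by rewrite trunc_logP// divn_gt0// minmag_lem.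
rewrite -[leLHS]real_normK ?num_real// norm_gval -mj -exprVn ler_sqr ?nnegrE ?divr_ge0//.
rewrite ler_pdivrMr ?mR_gt0// ler_pdivlMl ?exprn_gt0//.
by rewrite -natrX -natrM ler_nat.
Qed.

(** If some coordinate of [i] is not kept, both sides vanish: restriction zeroes that coordinate,
    and [i] either has coefficient zero or lies at a higher level. *)
Lemma light_restrict rho S z s i : (s <= S)%N ->
  light rho S z s i = light rho S (restrict (kept S s) z) s i.
Proof.
move=> sS; case: (boolP [forall j, kept S s (mag (z (j, i j)))]) => [/forallP kz|].
  have e := restrict_id kz; rewrite /light /level.
  by rewrite (heavy_ext rho e) (minmag_ext e) (coef_ext e).
rewrite negb_forall => /existsP[j nk].
have -> : light rho S (restrict (kept S s) z) s i = 0.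
  rewrite /light (coef_eq0 m_gt0 r_gt0) ?if_same//.
  have := minmag_le (restrict (kept S s) z) i j.
  by rewrite (mag_restrict m_gt0) (negbTE nk) leqn0 => /eqP.
rewrite /light; case: ifPn => // /andP[_ /eqP ls].
case: (posnP (minmag z i)) => [z0|zp]; first by rewrite (coef_eq0 m_gt0 r_gt0).
move: nk; rewrite negb_or -leqNgt => /andP[sS' mj].
have : (2 ^ s.+1 <= m %/ minmag z i)%N.
  rewrite leq_divRL// mulnC; apply: leq_trans mj.
  by rewrite leq_mul2r minmag_le orbT.
move/(trunc_log_max (ltnSn 1)); move: ls sS'; rewrite /level; lia.
Qed.

(** Below level [S], a vector of the unit ball has at most [4 ^ s.+1] entries above [2 ^- s.+1]. At
    level [S] the trivial count [n] suffices. *)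
Lemma card_supp_restrict S z s : in_ball z -> (n <= 4 ^ S)%N -> (s <= S)%N ->
  (#|supp (restrict (kept S s) z)| <= r * 4 ^ s.+1)%N.
Proof.
move=> bz nS sS.
pose F j v : nat := (j, v) \in supp (restrict (kept S s) z).
rewrite -sum1_card big_mkcond /= (eq_bigr (fun q => F q.1 q.2)); last first.
  by move=> [j v] _; rewrite /F; case: (_ \in _).
rewrite -(pair_bigA _ F) /=.
rewrite -[X in (_ <= X * _)%N]card_ord -sum_nat_const; apply: leq_sum => j _.
have [->|nsS] := eqVneq s S.
  apply: (@leq_trans n); last by rewrite (leq_trans nS)// leq_pexp2l.
  by rewrite -[leqRHS]card_ord -sum1_card; apply: leq_sum => v _; rewrite /F;
    case: (_ \in _).
rewrite -(leq_pmul2r (m := m ^ 2)) ?expn_gt0 ?m_gt0//.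
move/forallP: bz => /(_ j) bz.
rewrite [leqRHS]mulnC; apply: leq_trans (leq_mul bz (leqnn _)).
rewrite big_distrl big_distrl /=; apply: leq_sum => v _.
rewrite /F inE (mag_restrict m_gt0); case: ifPn => //; rewrite /kept (negbTE nsS) /= => mk.
have -> : (4 ^ s.+1 = (2 ^ s.+1) ^ 2)%N by rewrite -expnM mulnC expnM.
rewrite -expnMn.
case: (mag _ != 0%N); rewrite ?mul0n// mul1n leq_exp2r// ltnW//.
Qed.

Lemma light_heavy_decomp rho S (x : tensor_index n r -> R) z :
  \sum_i x i * coef z i = \sum_(i | heavy rho z i) x i * coef z i +
    \sum_(s < S.+1) \sum_i x i * light rho S z s i.
Proof.
rewrite (bigID (heavy rho z)) /=; congr (_ + _).
rewrite exchange_big big_mkcond /=; apply: eq_bigr => i _.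
rewrite -mulr_sumr.
have lS : (level S z i < S.+1)%N by rewrite ltnS geq_minl.
rewrite (bigD1 (Ordinal lS))//= /light eqxx andbT big1 ?addr0.
  by case: ifP => //; rewrite mulr0.
move=> s; rewrite -val_eqE /= eq_sym => /negbTE ->.
by rewrite andbF.
Qed.

(** The deterministic half of the argument: randomness will enter only through the hypotheses on
    light sums, heavy counts and fibers. *)
Lemma coef_sum_le (tau u K k : R) S (x b : tensor_index n r -> R) z :
  0 <= K -> 0 <= k -> (n <= 4 ^ S)%N ->
  (forall i, `|x i| <= b i) ->
  (forall s z', (s <= S)%N -> in_ball z' -> (#|supp z'| <= r * 4 ^ s.+1)%N ->
     `|\sum_i x i * light (tau ^+ 2) S z' s i| <= u) ->
  (forall z', in_ball z' ->
     \sum_(i | heavy (tau ^+ 2) z' i) b i <= K * #|supp z'|%:R) ->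
  (forall j i', \sum_(i | reset j i == i') b i <= k) ->
  in_ball z ->
  `|\sum_i x i * coef z i| <= S.+1%:R * u + r%:R * (K + k) / 2.
Proof.
move=> K0 k0 nS xb hu hK hk bz.
have b0 i : 0 <= b i by apply: le_trans (xb i).
rewrite (light_heavy_decomp (tau ^+ 2) S) [leRHS]addrC.
apply: le_trans (ler_normD _ _) _; apply: lerD; last first.
  apply: le_trans (ler_norm_sum _ _ _) _.
  rewrite -[S.+1 in leRHS]card_ord -sum1_card natr_sum mulr_suml; apply: ler_sum => s _.
  have sS : (s <= S)%N by rewrite -ltnS.
  rewrite mul1r (eq_bigr (fun i => x i * light (tau ^+ 2) S (restrict (kept S s) z) s i)).
    by apply: hu => //; [exact: in_ball_restrict|exact: card_supp_restrict].
  by move=> i _; rewrite light_restrict.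
apply: le_trans (ler_norm_sum _ _ _) _.
apply: (@le_trans _ _ ((\sum_(i | heavy (tau ^+ 2) z i) b i * ((minmag z i)%:R / m%:R) ^+ 2
   + \sum_j \sum_i b i * cofac z i j) / 2)).
  rewrite mulrDl exchange_big /= [X in _ + X]mulr_suml.
  apply: (@le_trans _ _ (\sum_(i | heavy (tau ^+ 2) z i)
    (b i * ((minmag z i)%:R / m%:R) ^+ 2 / 2 + (\sum_j b i * cofac z i j) / 2))).
    apply: ler_sum => i _; rewrite normrM -mulr_sumr -mulrDl -mulrDr -mulrA.
    by rewrite ler_pM ?coef_amgm.
  rewrite big_split /= -mulr_suml lerD2l [leRHS](bigID (heavy (tau ^+ 2) z)) /= lerDl.
  apply: sumr_ge0 => i _; rewrite divr_ge0//; apply: sumr_ge0 => j _.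
  by rewrite mulr_ge0 ?cofac_ge0.
rewrite ler_wpM2r ?invr_ge0// mulrDr lerD//.
  by rewrite mulrC; apply: heavy_minmag_sum.
rewrite -[r in leRHS]card_ord -sum1_card natr_sum mulr_suml; apply: ler_sum => j _.
by rewrite mul1r; apply: cofac_fiber_sum.
Qed.

End LightHeavy.

(** * The injective norm *)

Section InjectiveNorm.
Context {R : realType} (n r : nat).
Hypothesis n_gt0 : (0 < n)%N.
Implicit Types (A B D : tensor R n r).

Lemma norm_prod_sub (J : finType) (a b : J -> R) :
  (forall l, `|a l| <= 1) -> (forall l, `|b l| <= 1) ->
  `|\prod_l a l - \prod_l b l| <= \sum_l `|a l - b l|.
Proof.
move=> a1 b1.
suff [] : [/\ `|\prod_l a l - \prod_l b l| <= \sum_l `|a l - b l|,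
   `|\prod_l a l| <= 1 & `|\prod_l b l| <= 1] by [].
apply: (big_rec3 (fun u v d : R => [/\ `|u - v| <= d, `|u| <= 1 & `|v| <= 1])) => [|l u
  v d _ [IH u1 v1]].
  by rewrite subrr normr0 normr1.
have au : a l * u - b l * v = (a l - b l) * u + b l * (u - v) by ring.
split; rewrite ?normrM ?mulr_ile1 ?normr_ge0//.
rewrite au (le_trans (ler_normD _ _))// !normrM lerD//.
  by rewrite ler_piMr.
by apply: le_trans IH; rewrite ler_piMl.
Qed.

Lemma l2norm_ge0 (x : 'rV[R]_n) : 0 <= l2norm x.
Proof. exact: sqrtr_ge0. Qed.

Lemma l2norm_sqr (x : 'rV[R]_n) : l2norm x ^+ 2 = \sum_(v < n) x ord0 v ^+ 2.
Proof. by rewrite sqr_sqrtr//; apply: sumr_ge0 => v _; exact: sqr_ge0. Qed.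

Lemma norm_entry_le (x : 'rV[R]_n) v : `|x ord0 v| <= l2norm x.
Proof.
rewrite -ler_sqr ?nnegrE ?l2norm_ge0// l2norm_sqr real_normK ?num_real//.
by rewrite (bigD1 v)//= lerDl; apply: sumr_ge0 => u _; exact: sqr_ge0.
Qed.

Lemma l2normZ (c : R) (x : 'rV[R]_n) : 0 <= c -> l2norm (c *: x) = c * l2norm x.
Proof.
move=> c0; apply/eqP; rewrite -(@eqrXn2 _ 2) ?mulr_ge0 ?l2norm_ge0//.
rewrite exprMn !l2norm_sqr mulr_sumr; apply/eqP/eq_bigr => v _.
by rewrite mxE exprMn.
Qed.

Lemma inj_norm_le A (b : R) :
  (forall x : 'I_r -> 'rV[R]_n, (forall j, l2norm (x j) = 1) ->
     `|tensor_dot A (pure_tensor x)| <= b) -> inj_norm A <= b.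
Proof. by move=> Ab; have [[x x1 ->] _] := inj_normP A n_gt0; exact: Ab. Qed.

Lemma inj_norm_ge0 A : 0 <= inj_norm A.
Proof. by have [[x _ ->] _] := inj_normP A n_gt0. Qed.

(** By multilinearity the norms, all at most 1, can be pulled out. *)
Lemma le_inj_norm A (y : 'I_r -> 'rV[R]_n) : (forall j, l2norm (y j) <= 1) ->
  `|tensor_dot A (pure_tensor y)| <= inj_norm A.
Proof.
move=> y1; have [_ ub] := inj_normP A n_gt0.
pose e : 'rV[R]_n := delta_mx ord0 (Ordinal n_gt0).
have e1 : l2norm e = 1.
  apply/eqP; rewrite -(@eqrXn2 _ 2 _ 1) ?l2norm_ge0// l2norm_sqr expr1n.
  rewrite (bigD1 (Ordinal n_gt0))//= big1 ?mxE ?eqxx ?expr1n ?addr0// => v v0.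
  by rewrite mxE (negbTE v0) andbF expr0n.
(* A zero vector cannot be normalized; any unit vector may replace it, as its factor is [0]. *)
pose u j := if l2norm (y j) == 0 then e else (l2norm (y j))^-1 *: y j.
have u1 j : l2norm (u j) = 1.
  rewrite /u; case: eqP => // /eqP yj.
  by rewrite l2normZ ?invr_ge0 ?l2norm_ge0// mulVf.
have yu j v : y j ord0 v = l2norm (y j) * u j ord0 v.
  rewrite /u; case: eqP => [yj|/eqP yj]; last by rewrite mxE mulVKf.
  by apply/eqP; rewrite yj mul0r -normr_le0 -yj norm_entry_le.
have -> : tensor_dot A (pure_tensor y) =
    (\prod_j l2norm (y j)) * tensor_dot A (pure_tensor u).
  rewrite /tensor_dot mulr_sumr; apply: eq_bigr => i _.
  rewrite mulrCA /pure_tensor -big_split /=; congr (_ * _).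
  by apply: eq_bigr => j _; rewrite yu.
rewrite normrM; apply: le_trans (ub _ (ex_intro2 _ _ u u1 erefl)).
rewrite ler_piMl// normr_prod; apply: prodr_ile1 => j _.
by rewrite normr_ge0 ger0_norm ?l2norm_ge0 ?y1.
Qed.

(** Entries of unit vectors are at most 1 in absolute value, so the error costs at most its l1
    norm. *)
Lemma inj_norm_perturb A B D (c : R) : 0 <= c ->
  (forall i, A i = c * B i + D i) -> inj_norm A <= c * inj_norm B + \sum_i `|D i|.
Proof.
move=> c0 AE; apply: inj_norm_le => x x1.
have -> : tensor_dot A (pure_tensor x) =
    c * tensor_dot B (pure_tensor x) + tensor_dot D (pure_tensor x).
  rewrite /tensor_dot mulr_sumr -big_split /=; apply: eq_bigr => i _.
  by rewrite AE; ring.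
apply: le_trans (ler_normD _ _) _; apply: lerD.
  by rewrite normrM ger0_norm// ler_wpM2l// le_inj_norm// => j; rewrite x1.
apply: le_trans (ler_norm_sum _ _ _) _; apply: ler_sum => i _.
rewrite normrM ler_piMr// /pure_tensor normr_prod; apply: prodr_ile1 => j _.
by rewrite normr_ge0 -(x1 j) norm_entry_le.
Qed.

Lemma tensor_dot_grid m (z : grid n r m) A :
  \sum_i A i * coef z i =
  tensor_dot A (pure_tensor (fun j => \row_v gval (z (j, v)))).
Proof.
by apply: eq_bigr => i _; congr (_ * _); apply: eq_bigr => j _; rewrite mxE.
Qed.

Lemma le_inj_norm_grid m (z : grid n r m) A : (0 < m)%N -> in_ball z ->
  `|\sum_i A i * coef z i| <= inj_norm A.
Proof.
move=> m0 bz; rewrite tensor_dot_grid le_inj_norm// => j.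
rewrite -(@ler_sqr _ _ 1) ?nnegrE ?l2norm_ge0// l2norm_sqr expr1n.
by under eq_bigr do rewrite mxE; exact: gval_ball.
Qed.

(** Round the maximizing unit vectors towards zero. They stay in the unit ball, and a product of [r]
    entries moves by at most [r / m]. *)
Lemma inj_norm_grid m A : (0 < m)%N -> exists2 z : grid n r m, in_ball z &
  inj_norm A <= `|\sum_i A i * coef z i| + (\sum_i `|A i|) * (r%:R / m%:R).
Proof.
move=> m0; have [[x x1 ->] _] := inj_normP A n_gt0.
have xv1 j v : `|x j ord0 v| <= 1 by rewrite -(x1 j) norm_entry_le.
exists [ffun q => round0 m (x q.1 ord0 q.2)].
  apply/forallP => j; have mp := mR_gt0 (R := R) m0.
  rewrite -(ler_nat R) natr_sum natrX -[leRHS]mul1r -ler_pdivrMr ?exprn_gt0//.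
  rewrite mulr_suml [leRHS](_ : _ = l2norm (x j) ^+ 2); last by rewrite x1 expr1n.
  rewrite l2norm_sqr; apply: ler_sum => v _; rewrite -gval_sqr ffunE /=.
  rewrite -[leLHS]real_normK ?num_real// -[leRHS]real_normK ?num_real// ler_sqr ?nnegrE//.
  by have [] := round0_spec m0 (xv1 j v).
rewrite -lerBlDl; apply: le_trans (lerB_dist _ _) _.
rewrite /tensor_dot -sumrB mulr_suml.
apply: le_trans (ler_norm_sum _ _ _) _; apply: ler_sum => i _.
rewrite -mulrBr normrM ler_wpM2l//.
apply: le_trans (norm_prod_sub _ _) _ => [j|j|]; first exact: xv1.
  exact: gval_le1.
rewrite -[r in leRHS]card_ord -sum1_card natr_sum mulr_suml; apply: ler_sum => j _.
by rewrite mul1r ffunE /=; have [] := round0_spec m0 (xv1 j (i j)).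
Qed.

End InjectiveNorm.

(** * Deviation bounds and the union bound *)

Section SupportWeights.
Context {R : realType} (n r m : nat).
Hypothesis m_gt0 : (0 < m)%N.

Lemma card_mag_neq0 : #|[pred g : 'I_(2 * m).+1 | mag g != 0%N]| = (2 * m)%N.
Proof.
have -> : #|[pred g : 'I_(2 * m).+1 | mag g != 0%N]| = #|predC1 (gzero m)|.
  apply: eq_card => g; rewrite !inE -val_eqE /= gzeroE// /mag.
  by congr (~~ _); apply/eqP/eqP; lia.
by have := cardC1 (gzero m); rewrite card_ord.
Qed.

(** A generating function: each of the [r * n] positions contributes 1 for the value zero and [w]
    for each of the [2 * m] nonzero values. *)
Lemma sum_supp_weight (w : R) :
  \sum_(z : grid n r m) w ^+ #|supp z| = (1 + (2 * m)%:R * w) ^+ (r * n).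
Proof.
transitivity (\sum_(z : grid n r m) \prod_q (if mag (z q) != 0%N then w else 1)).
  apply: eq_bigr => z _; rewrite -big_mkcond /= prodr_const; congr (_ ^+ _).
  by apply: eq_card => q; rewrite !inE.
rewrite -(bigA_distr_bigA (fun q g => if mag g != 0%N then w else 1)) /=.
rewrite prodr_const card_prod !card_ord; congr (_ ^+ _).
rewrite (bigID (fun g => mag g != 0%N)) /= addrC; congr (_ + _).
  rewrite (bigD1 (gzero m)) ?mag_gzero//= big1 ?addr0 => [//|g].
  rewrite -val_eqE /= gzeroE// => /andP[]; rewrite negbK /mag; lia.
rewrite -[in RHS]card_mag_neq0 mulr_natl -sumr_const; apply: eq_bigr => g.
by move=> ->.
Qed.

(* One factor [w] per support point: this replaces counting the grid tuples of
   given support size in the union bounds. *)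
Lemma sum_supp_weight_le (w : R) : 0 <= w -> (2 * m * n)%:R * w <= 1 ->
  \sum_(z : grid n r m) w ^+ #|supp z| <= expR r%:R.
Proof.
move=> w0 mw; rewrite sum_supp_weight.
apply: (@le_trans _ _ (expR ((2 * m)%:R * w) ^+ (r * n))).
  by rewrite lerXn2r ?nnegrE ?addr_ge0 ?mulr_ge0 ?expR_ge0 ?expR_ge1Dx.
rewrite -expRM_natl ler_expR natrM -mulrA ler_piMr//.
by rewrite mulrA -natrM mulnC.
Qed.

End SupportWeights.

Section Deviation.
Context {R : realType} (I V : finType) (mu : I -> V -> R) (val : V -> R) (p : R).
Hypothesis mu_ge0 : forall i v, 0 <= mu i v.
Hypothesis mu_sum : forall i, \sum_v mu i v = 1.
Hypothesis mu_p : forall i, \sum_(v | val v != 0) mu i v <= p.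
Hypothesis val_le1 : forall v, `|val v| <= 1.

Lemma count_deviation (A : pred I) (a c : R) : 0 < a ->
  prod_prob mu (fun f => c < \sum_(i | A i) (val (f i) != 0)%:R) <=
  expR ((\sum_(i | A i) 1) * (p * expR a) - a * c).
Proof.
move=> a0.
pose phi i v : R := if A i then a * (val v != 0)%:R else 0.
pose b i : R := if A i then p * expR a else 0.
apply: le_trans (prod_prob_le mu_ge0 _) (le_trans (exp_markov mu_ge0 (phi := phi) (b :=
  b) (a * c) _) _).
- by move=> f; rewrite -(ltr_pM2l a0) mulr_sumr /phi big_mkcond.
- move=> i; rewrite /phi /b; case: (A i); first exact: mgf_nonzero (ltW a0).
  by under eq_bigr do rewrite expR0 mulr1; rewrite mu_sum expR0.
- by rewrite /b -big_mkcond mulr_suml; under [in leRHS]eq_bigr do rewrite mul1r.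
Qed.

Hypothesis p_ge0 : 0 <= p.

Lemma linear_deviation1 (c : I -> R) (a u : R) : 0 < a ->
  (forall i, a * `|c i| <= 1 / 4) -> \sum_i c i ^+ 2 <= 1 ->
  prod_prob mu (fun f => u < \sum_i (val (f i) - fmean (mu i) val) * c i) <=
  expR (2 * a ^+ 2 * p - a * u).
Proof.
move=> a0 ac c1.
pose phi i v : R := (a * c i) * (val v - fmean (mu i) val).
pose b i : R := 2 * (a * c i) ^+ 2 * p.
apply: le_trans (prod_prob_le mu_ge0 _) (le_trans (exp_markov mu_ge0 (phi := phi) (b :=
  b) (a * u) _) _).
- move=> f; rewrite -(ltr_pM2l a0) mulr_sumr /phi => /lt_le_trans; apply.
  by apply: ler_sum => i _; rewrite mulrA mulrAC.
- move=> i; apply: mgf_centered => //.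
  by rewrite normrM ger0_norm// ltW.
- rewrite ler_expR lerD2r /b -mulr_suml -mulr_sumr.
  under eq_bigr do rewrite exprMn.
  by rewrite -mulr_sumr ler_wpM2r// ler_wpM2l// ler_piMr// sqr_ge0.
Qed.

Lemma linear_deviation (c : I -> R) (a u : R) : 0 < a ->
  (forall i, a * `|c i| <= 1 / 4) -> \sum_i c i ^+ 2 <= 1 ->
  prod_prob mu (fun f => u < `|\sum_i (val (f i) - fmean (mu i) val) * c i|) <=
  2 * expR (2 * a ^+ 2 * p - a * u).
Proof.
move=> a0 ac c1; rewrite mulr_natl mulr2n.
have h1 := linear_deviation1 u a0 ac c1.
have h2 : prod_prob mu (fun f => u < \sum_i (val (f i) - fmean (mu i) val) * (- c i)) <=
  expR (2 * a ^+ 2 * p - a * u).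
  apply: linear_deviation1 => // [i|]; first by rewrite normrN.
  by under eq_bigr do rewrite sqrrN.
apply: le_trans (lerD h1 h2); apply: le_trans (prod_prob_or mu_ge0 _ _).
apply: prod_prob_le => // f; rewrite ltr_normr => /orP[->//|uf].
by under [in X in _ || X]eq_bigr do rewrite mulrN; rewrite sumrN uf orbT.
Qed.

End Deviation.

(** * Tail bound for finitely valued entries *)

Section FiniteTensor.
Context {R : realType} (n r : nat) (eps L t : R).
Hypotheses (n_ge2 : (2 <= n)%N) (r_ge2 : (2 <= r)%N).
Hypotheses (eps_gt0 : 0 < eps) (eps_lt1 : eps < 1) (L_ge1 : 1 <= L) (t_gt0 : 0 < t).

(* [m] is the grid resolution, [S] the last dyadic level, [tau ^+ 2] the threshold
   separating light from heavy indices. *)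
Local Notation l := (ln (n%:R : R)).
Local Notation p := (L * expR (- (1 + eps) * l)).
Local Notation m := (n ^ (2 * r + 1))%N.
Local Notation S := (up_log 4 n).
Local Notation tau := (expR (- (1 / 2 + eps / 4) * l) / 2).

Let n_gt0 : (0 < n)%N. Proof. exact: ltnW. Qed.
Let r_gt0 : (0 < r)%N. Proof. exact: ltnW. Qed.
Let m_gt0 : (0 < m)%N. Proof. by rewrite expn_gt0 n_gt0. Qed.

Lemma expR_ln_nat : expR l = n%:R.
Proof. by rewrite lnK// posrE ltr0n. Qed.

Lemma ln_nat_ge : 1 / 2 <= l.
Proof.
rewrite -ler_expR expR_ln_nat; apply: (@le_trans _ _ 2); last by rewrite ler_nat.
have := expR_ge1Dx (- (1 / 2) : R); rewrite expRN => h.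
have e0 := expR_gt0 (1 / 2 : R).
rewrite -[leRHS]invrK -[leLHS]invrK lef_pV2 ?posrE ?invr_gt0//; lra.
Qed.

Let l0 : 0 < l. Proof. by have := ln_nat_ge; lra. Qed.

Lemma expR_ln_natX k : expR (k%:R * l) = (n ^ k)%:R.
Proof. by rewrite expRM_natl expR_ln_nat natrX. Qed.

Lemma p_ge0 : 0 <= p.
Proof. by rewrite mulr_ge0 ?expR_ge0// (le_trans ler01). Qed.

(** A fiber has at most [n] indices, so its mean number of nonzero entries is at most [n * p]; the
    tilt [eps * l] raises this bound to exactly [L]. *)
Lemma np_le : n%:R * p * expR (eps * l) = L.
Proof.
rewrite -{1}expR_ln_nat mulrCA -mulrA -mulrA -!expRD [X in expR X](_ : _ = 0) ?expR0
  ?mulr1//.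
by ring.
Qed.

(** With [card_heavy], the mean number of nonzero heavy entries is at most [4 * L * n^(-eps/2)]
    times the support size. *)
Lemma p_tau : p = 4 * L * expR (- (eps / 2) * l) * tau ^+ 2.
Proof.
rewrite expr_div_n -expRM_natl.
rewrite [RHS](_ : _ = L * (expR (- (eps / 2) * l) * expR (2%:R * (- (1 / 2 + eps / 4) *
  l)))); last by field.
by rewrite -expRD; congr (_ * expR _); field.
Qed.

Lemma support_weight_sum :
  \sum_(z : grid n r m) expR (- (4 * r%:R) * l) ^+ #|supp z| <= expR r%:R.
Proof.
apply: sum_supp_weight_le; rewrite ?expR_ge0//.
rewrite mulNr expRN -natrM expR_ln_natX ler_pdivrMr ?mul1r ?ler_nat ?ltr0n ?expn_gt0
  ?n_gt0//.
(* [2 * m * n <= n ^ (2 * r + 3) <= n ^ (4 * r)], the last since [r >= 2]. *)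
apply: (@leq_trans (n * n ^ (2 * r + 1) * n)); first by rewrite !leq_mul2r n_ge2 !orbT.
by rewrite -expnS -expnSr leq_pexp2l//; lia.
Qed.

Lemma up_log_ltn : (S.+1 <= n)%N.
Proof.
have := up_log_gtn (isT : (1 < 4)%N) n_ge2.
have : (0 < S)%N by rewrite up_log_gt0.
have := ltn_expl S.-1 (isT : (1 < 4)%N); lia.
Qed.

Lemma exp2_level s : (s <= S)%N -> 2 ^+ s <= 2 * expR (1 / 2 * l).
Proof.
move=> sS; apply: (@le_trans _ _ (2 ^+ S)); first by rewrite ler_eXn2l// ?ltr1n.
rewrite -ler_sqr ?nnegrE ?exprn_ge0 ?mulr_ge0 ?expR_ge0//.
rewrite exprMn -expRM_natl [X in expR X](_ : _ = l) ?expR_ln_nat; last by field.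
rewrite -exprM mulnC exprM -natrX -natrX -natrM ler_nat.
have /= := up_log_gtn (isT : (1 < 4)%N) n_ge2.
have : (0 < S)%N by rewrite up_log_gt0.
case: (up_log 4 n) => //= k _ kn; rewrite (_ : 2 ^ 2 = 4)%N// expnS leq_mul2l /= ltnW//.
Qed.

Context (V : finType) (mu : tensor_index n r -> V -> R) (val : V -> R).
Hypothesis mu_ge0 : forall i v, 0 <= mu i v.
Hypothesis mu_sum : forall i, \sum_v mu i v = 1.
Hypothesis mu_p : forall i, \sum_(v | val v != 0) mu i v <= p.
Hypothesis val_le1 : forall v, `|val v| <= 1.

Local Notation cnt A f := (\sum_(i | A i) (val (f i) != 0)%:R : R).

(** Chernoff with tilt [eps * l]: [2 * L] pays for the exponential moment, [2 * r] for the union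
    over fibers and [t + 2] for the probability. *)
Definition fiber_bound : R := (2 * L + 2 * r%:R + t + 2) / eps.
(** Chernoff with tilt [eps / 2 * l]: [8 * L] pays for the exponential moment; of [6 * r], four
    parts pay for the weight of each support point and two for the total weight [expR r]. *)
Definition heavy_bound : R := 2 * (8 * L + 6 * r%:R + t + 2) / eps.
(** The terms pay, in order, for the variance, the union over grid tuples and the probability. *)
Definition light_bound : R := 2 * L * expR (- (3 / 4 * eps) * l)
  + 68 * r%:R ^+ 2 * l * expR (- (eps / 4) * l)
  + 2 * expR (- (1 / 2) * l) * l * (t + 4).

Lemma fiber_event : prod_prob mu (fun f => [exists q : 'I_r * tensor_index n r,
    fiber_bound < cnt (fun i => reset n_gt0 q.1 i == q.2) f]) <= expR (- (t + 2) * l).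
Proof.
apply: le_trans (prod_prob_exists mu_ge0 _) _.
apply: (@le_trans _ _ (\sum_(q : 'I_r * tensor_index n r) expR (- (2 * r%:R + t + 2) * l))).
  apply: ler_sum => -[j i'] _ /=.
  apply: le_trans (count_deviation mu_ge0 mu_sum mu_p _ _ (mulr_gt0 eps_gt0 l0)) _.
  rewrite ler_expR.
  have c1 : \sum_(i | reset n_gt0 j i == i') 1 <= n%:R :> R.
    rewrite (_ : \sum_(i | _) 1 = #|[pred i | reset n_gt0 j i == i']|%:R) ?ler_nat
      ?card_fiber//.
    by rewrite -sumr_const.
  have c2 : (\sum_(i | reset n_gt0 j i == i') 1) * (p * expR (eps * l)) <= L.
    rewrite -[leRHS]np_le -[leRHS]mulrA ler_wpM2r// mulr_ge0 ?expR_ge0// p_ge0//.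
  have -> : eps * l * fiber_bound = l * (2 * L + 2 * r%:R + t + 2).
    by rewrite /fiber_bound; field; rewrite gt_eqF.
  apply: le_trans (lerD c2 (lexx _)) _.
  have := ln_nat_ge; have := L_ge1; nra.
(* The union is over [r * n ^ r <= n ^ (2 * r)] pairs. *)
rewrite sumr_const card_prod card_ord card_ffun !card_ord -[leLHS]mulr_natl natrM.
have rn : r%:R <= expR (r%:R * l) :> R.
  rewrite expR_ln_natX ler_nat; apply: leq_trans (ltnW (ltn_expl r (isT : (1 < 2)%N))) _.
  by rewrite leq_exp2r.
rewrite -expR_ln_natX.
apply: (@le_trans _ _ (expR (r%:R * l) * expR (r%:R * l) * expR (- (2 * r%:R + t + 2) *
  l))).
  by rewrite !ler_wpM2r ?expR_ge0.
by rewrite -!expRD ler_expR; lra.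
Qed.

(** A weighted union bound: [z] fails with probability at most [n^(-4r)] per support point, times
    [expR (- r)] and [n^(-t-2)], and [support_weight_sum] adds up the weights. *)
Lemma heavy_event : prod_prob mu (fun f => [exists z : grid n r m,
    in_ball z && (heavy_bound * #|supp z|%:R < cnt (heavy (tau ^+ 2) z) f)])
  <= expR (- (t + 2) * l).
Proof.
have tau0 : 0 < tau ^+ 2 by rewrite exprn_gt0// divr_gt0// expR_gt0.
apply: le_trans (prod_prob_exists mu_ge0 _) _.
apply: (@le_trans _ _ (\sum_(z : grid n r m)
    expR (- (4 * r%:R) * l) ^+ #|supp z| * (expR (- r%:R) * expR (- (t + 2) * l))));
      last first.
  rewrite -mulr_suml mulrA ler_piMl ?expR_ge0//.
  by rewrite expRN ler_pdivrMr ?expR_gt0// mul1r support_weight_sum.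
apply: ler_sum => z _.
have [bz|_] /= := boolP (in_ball z); last first.
  rewrite /prod_prob big_pred0// !mulr_ge0 ?exprn_ge0 ?expR_ge0//.
(* With empty support no index is heavy. Otherwise the support size is at least 1, and every term of
   the exponent can be compared with a multiple of it. *)
have [s0|sp] := posnP #|supp z|.
  rewrite s0 mulr0 /prod_prob big_pred0 ?mulr_ge0 ?exprn_ge0 ?expR_ge0// => f.
  apply/negbTE; rewrite -leNgt big1// => i /andP[mi _].
  exfalso; have [j mj] := minmag_attained m_gt0 r_gt0 z i.
  by have := card0_eq s0 (j, i j); rewrite inE -mj -lt0n mi.
apply: le_trans (count_deviation mu_ge0 mu_sum mu_p _ _ (a := eps / 2 * l) _) _.
  by rewrite mulr_gt0// divr_gt0.
rewrite -expRM_natl -!expRD ler_expR.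
have sp1 : 1 <= #|supp z|%:R :> R by rewrite ler1n.
have c1 := card_heavy m_gt0 tau0 bz.
have c2 : (\sum_(i | heavy (tau ^+ 2) z i) 1) * (p * expR (eps / 2 * l)) <= 4 * L *
  #|supp z|%:R.
  apply: le_trans (ler_wpM2r _ c1) _; first by rewrite mulr_ge0 ?expR_ge0// p_ge0.
  rewrite p_tau; move: (tau ^+ 2) tau0 => T T0.
  rewrite [leLHS](_ : _ = 4 * L * #|supp z|%:R * (expR (- (eps / 2) * l) * expR (eps /
    2 * l))); last first.
    by field; rewrite gt_eqF.
  by rewrite -expRD mulNr addNr expR0 mulr1.
have -> : eps / 2 * l * (heavy_bound * #|supp z|%:R) = l * (8 * L + 6 * r%:R + t + 2) *
  #|supp z|%:R.
  by rewrite /heavy_bound; field; rewrite gt_eqF.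
apply: le_trans (lerD c2 (lexx _)) _.
have lh := ln_nat_ge; have L1 := L_ge1; have t0 := t_gt0; have r0 : 0 <= r%:R :> R by [].
move: (#|supp z|%:R) sp1 => s s1.
have h1 : L <= 2 * L * l by nra.
have h2 : r%:R <= 2 * r%:R * l by nra.
have h3 : (2 * r%:R * l + (t + 2) * l) <= (2 * r%:R * l + (t + 2) * l) * s.
  by rewrite ler_peMr// addr_ge0// mulr_ge0 ?mulr_ge0// ltW// ?addr_gt0.
have h4 : 4 * L * s <= 8 * L * l * s by nra.
nra.
Qed.

Local Notation dev f := (fun i => val (f i) - fmean (mu i) val).

(** The tilt [2 ^+ s / (4 * tau)] is the largest for which [light_le] keeps tilted coefficients
    within [1 / 4]. The resulting Chernoff exponent must beat the weight of [z], whose support size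
    is [sg]. *)
Lemma light_exponent (s : nat) (sg : R) : (s <= S)%N ->
  sg <= r%:R * 4 ^+ s.+1 ->
  2 * (2 ^+ s / (4 * tau)) ^+ 2 * p - 2 ^+ s / (4 * tau) * light_bound <=
  sg * (- (4 * r%:R) * l) + (- r%:R + - (t + 4) * l).
Proof.
move=> sS sgs; have P2G := exp2_level sS.
have lh := ln_nat_ge; have L1 := L_ge1; have t0 := t_gt0.
have r2 : 2 <= r%:R :> R by rewrite ler_nat.
have G1 : 1 <= expR (1 / 2 * l) by apply: le_trans (expR_ge1Dx _); lra.
have H1 : 1 <= expR (eps / 4 * l) by apply: le_trans (expR_ge1Dx _); have := eps_gt0; nra.
have P1 : 1 <= 2 ^+ s :> R by rewrite exprn_ege1// ler1n.
have P4 : 4 ^+ s.+1 = 4 * (2 ^+ s) ^+ 2 :> R.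
  by rewrite exprS -exprM mulnC exprM; congr (_ * _ ^+ _); rewrite -natrX.
rewrite {}P4 in sgs.
rewrite /light_bound.
have e1 : expR (- (1 / 2 + eps / 4) * l) = (expR (1 / 2 * l))^-1 * (expR (eps / 4 * l))^-1.
  by rewrite -!expRN -expRD; congr expR; field.
have e2 : expR (- (1 + eps) * l) = (expR (1 / 2 * l))^-1 ^+ 2 * (expR (eps / 4 * l))^-1
  ^+ 4.
  by rewrite -!expRN -!expRM_natl -expRD; congr expR; field.
have e3 : expR (- (3 / 4 * eps) * l) = (expR (eps / 4 * l))^-1 ^+ 3.
  by rewrite -!expRN -!expRM_natl; congr expR; field.
have e4 : expR (- (eps / 4) * l) = (expR (eps / 4 * l))^-1 by rewrite -expRN mulNr.
have e5 : expR (- (1 / 2) * l) = (expR (1 / 2 * l))^-1 by rewrite -expRN mulNr.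
rewrite {}e1 {}e2 {}e3 {}e4 {}e5.
(* From here [G], [H], [P] stand for [n^(1/2)], [n^(eps/4)], [2 ^+ s], and [P <= 2 * G]. *)
move: (expR (1 / 2 * l)) (expR (eps / 4 * l)) (2 ^+ s) P2G G1 H1 P1 sgs => G H P P2G G1
  H1 P1 sgs.
have G0 : G != 0 by rewrite gt_eqF//; lra.
have H0 : H != 0 by rewrite gt_eqF//; lra.
have -> : 2 * (P / (4 * (G^-1 * H^-1 / 2))) ^+ 2 * (L * (G^-1 ^+ 2 * H^-1 ^+ 4)) =
    P ^+ 2 / 2 * (L * H^-1 ^+ 2) by field; rewrite G0 H0.
have -> : P / (4 * (G^-1 * H^-1 / 2)) *
   (2 * L * H^-1 ^+ 3 + 68 * r%:R ^+ 2 * l * H^-1 + 2 * G^-1 * l * (t + 4)) =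
   P * G * (L * H^-1 ^+ 2) + 34 * (r%:R ^+ 2 * l * (P * G)) + P * H * (l * (t + 4)).
  by field; rewrite G0 H0.
have PG1 : 1 <= P * G by nra.
(* [q1] absorbs the variance. The [34] splits into [32] for the support weight ([q2]) and [2] for
   the normalization [r] ([q3]). *)
have q1 : P ^+ 2 / 2 * (L * H^-1 ^+ 2) <= P * G * (L * H^-1 ^+ 2).
  by apply: ler_wpM2r; [apply: mulr_ge0; [lra|exact: sqr_ge0]|nra].
have q2 : sg * (4 * r%:R * l) <= 32 * (r%:R ^+ 2 * l * (P * G)).
  apply: (@le_trans _ _ (r%:R * (4 * P ^+ 2) * (4 * r%:R * l))).
    by apply: ler_wpM2r => //; rewrite !mulr_ge0//; lra.
  have -> : r%:R * (4 * P ^+ 2) * (4 * r%:R * l) = 16 * (r%:R ^+ 2 * l) * P ^+ 2 by ring.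
  have -> : 32 * (r%:R ^+ 2 * l * (P * G)) = 16 * (r%:R ^+ 2 * l) * (2 * (P * G)) by ring.
  apply: ler_wpM2l; last by nra.
  by apply: mulr_ge0 => //; apply: mulr_ge0; [exact: sqr_ge0|lra].
have q3 : r%:R <= 2 * (r%:R ^+ 2 * l * (P * G)).
  have a1 : r%:R <= r%:R ^+ 2 :> R by nra.
  have a2 : r%:R ^+ 2 <= r%:R ^+ 2 * (2 * l) by rewrite ler_peMr ?sqr_ge0//; lra.
  have a3 : r%:R ^+ 2 * (2 * l) <= r%:R ^+ 2 * (2 * l) * (P * G).
    by rewrite ler_peMr// mulr_ge0 ?sqr_ge0//; lra.
  by lra.
have q4 : l * (t + 4) <= P * H * (l * (t + 4)).
  by rewrite ler_peMl//; [rewrite mulr_ge0//; lra|nra].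
lra.
Qed.

(** Two-sidedness and the union over levels cost [2 * S.+1 <= n ^ 2], which lowers [t + 4] to
    [t + 2]. *)
Lemma light_event : prod_prob mu (fun f => [exists q : 'I_S.+1 * grid n r m,
    [&& in_ball q.2, (#|supp q.2| <= r * 4 ^ q.1.+1)%N &
      light_bound < `|\sum_i dev f i * light (tau ^+ 2) S q.2 q.1 i|]])
  <= expR (- (t + 2) * l).
Proof.
have tau0 : 0 < tau by rewrite divr_gt0// expR_gt0.
apply: le_trans (prod_prob_exists mu_ge0 _) _.
apply: (@le_trans _ _ (\sum_(q : 'I_S.+1 * grid n r m)
   2 * (expR (- (4 * r%:R) * l) ^+ #|supp q.2| * (expR (- r%:R) * expR (- (t + 4) *
     l))))); last first.
  rewrite -(pair_bigA _ (fun (s : 'I_S.+1) (z : grid n r m) =>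
    2 * (expR (- (4 * r%:R) * l) ^+ #|supp z| * (expR (- r%:R) * expR (- (t + 4) *
      l))))) /=.
  rewrite sumr_const card_ord -mulr_sumr -mulr_suml -[leLHS]mulr_natl.
  apply: (@le_trans _ _ (S.+1%:R * (2 * expR (- (t + 4) * l)))).
    rewrite !ler_wpM2l// mulrA ler_piMl ?expR_ge0//.
    by rewrite expRN ler_pdivrMr ?expR_gt0// mul1r support_weight_sum.
  rewrite mulrA; apply: (@le_trans _ _ (expR (2%:R * l) * expR (- (t + 4) * l))).
    rewrite ler_wpM2r ?expR_ge0// expR_ln_natX -natrM ler_nat.
    by have := up_log_ltn; have := n_ge2; nia.
  by rewrite -expRD ler_expR; lra.
apply: ler_sum => -[s z] _ /=.
have [bz|_] /= := boolP (in_ball z); last first.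
  by rewrite /prod_prob big_pred0// !mulr_ge0 ?exprn_ge0 ?expR_ge0.
case: leqP => [sz|_] /=; last first.
  by rewrite /prod_prob big_pred0// !mulr_ge0 ?exprn_ge0 ?expR_ge0.
have sS : (s <= S)%N by rewrite -ltnS.
apply: le_trans (linear_deviation mu_ge0 mu_sum mu_p val_le1 p_ge0 _ (a := 2 ^+ s / (4
  * tau)) _ _ _) _.
- by apply: divr_gt0; rewrite ?exprn_gt0//; apply: mulr_gt0.
- move=> i; apply: (@le_trans _ _ (2 ^+ s / (4 * tau) * (tau / 2 ^+ s))).
    apply: ler_wpM2l.
      by apply: divr_ge0; rewrite ?exprn_ge0//; apply: mulr_ge0 => //; exact: ltW.
    exact: light_le (ltW tau0).
  rewrite le_eqVlt; apply/orP; left; apply/eqP.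
  move: tau tau0 => T T0; field; rewrite (gt_eqF T0)/= expf_neq0//.
- apply: le_trans (coef_sqr_sum (R := R) m_gt0 bz); apply: ler_sum => i _.
  by rewrite /light; case: ifP => // _; rewrite expr0n sqr_ge0.
rewrite ler_pM2l// -expRM_natl -!expRD ler_expR light_exponent//.
by rewrite -natrX -natrM ler_nat.
Qed.

(** [4 * L] and [L] account for the entry means, at most [p] each, on heavy indices and on fibers.
    The final [1] is the grid rounding error. *)
Definition inj_bound : R :=
  S.+1%:R * light_bound +
  r%:R * ((heavy_bound + 4 * L) + (fiber_bound + L)) / 2 + 1.

Lemma finite_tail_raw :
  prod_prob mu (fun f => inj_bound < inj_norm (dev f)) <= expR (- t * l).
Proof.
(* Three bad events cost [3 / n ^ 2 <= 3 / 4] of the target. *)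
apply: (@le_trans _ _ (expR (- (t + 2) * l) + (expR (- (t + 2) * l) + expR (- (t + 2) *
  l)))); last first.
  have -> : - (t + 2) * l = - t * l + - (2%:R * l) by ring.
  rewrite expRD expRN expR_ln_natX; move: (expR_gt0 (- t * l)) => e0.
  have : (n ^ 2)%:R^-1 <= 4^-1 :> R.
    by rewrite lef_pV2 ?posrE ?ltr0n ?expn_gt0 ?n_gt0// ler_nat -[4%N]/(2 ^ 2)%N leq_exp2r.
  nra.
apply: le_trans (lerD light_event (lerD heavy_event fiber_event)).
apply: le_trans (lerD (lexx _) (prod_prob_or mu_ge0 _ _)).
apply: le_trans (prod_prob_or mu_ge0 _ _).
apply: prod_prob_le => // f; apply: contraTT; rewrite !negb_or -leNgt.
move=> /and3P[/existsPn nL /existsPn nH /existsPn nF].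
have tau0 : 0 < tau ^+ 2 by rewrite exprn_gt0// divr_gt0// expR_gt0.
have L0 : 0 <= L by apply: le_trans L_ge1.
have t0 := ltW t_gt0; have r0 : 0 <= r%:R :> R by [].
have [z bz zinj] := inj_norm_grid n_gt0 (dev f) m_gt0.
apply: le_trans zinj _; apply: lerD; last first.
  have d2 i : `|dev f i| <= 2.
    have := ler_normB (val (f i)) (fmean (mu i) val); have := val_le1 (f i).
    by have := fmean_le1 (mu_ge0 i) (mu_sum i) val_le1; lra.
  (* The choice of [m] makes the rounding error at most 1: [2 * n ^ r * r <= n ^ (2 * r + 1)]. *)
  apply: (@le_trans _ _ (\sum_(i : tensor_index n r) 2 * (r%:R / m%:R))).
    by rewrite mulr_suml; apply: ler_sum => i _; rewrite ler_wpM2r// divr_ge0.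
  rewrite sumr_const card_ffun !card_ord -[leLHS]mulr_natl !mulrA ler_pdivrMr ?mR_gt0//
    mul1r.
  rewrite -!natrM ler_nat addn1 expnS mul2n -addnn expnD.
  have rn : (r <= n ^ r)%N.
    by apply: leq_trans (ltnW (ltn_expl r (isT : (1 < 2)%N))) _; rewrite leq_exp2r.
  rewrite -mulnA mulnC -mulnA; apply: leq_mul => //.
  by apply: leq_mul.
(* [b] dominates the centered entry: the indicator bounds the value, [p] the mean. *)
pose b i : R := (val (f i) != 0)%:R + p.
apply: (coef_sum_le m_gt0 r_gt0 (tau := tau) (b := b) (n_gt0 := n_gt0)) => //.
- by apply: addr_ge0; [apply: divr_ge0; [lra|exact: ltW]|lra].
- by apply: addr_ge0; [apply: divr_ge0; [lra|exact: ltW]|].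
- exact: up_logP.
- move=> i; apply: le_trans (ler_normB _ _) _; apply: lerD.
    by case: eqP => [->|_]; rewrite ?normr0.
  exact: fmean_le.
- move=> s z' sS bz' sz'; rewrite leNgt.
  by have := nL (Ordinal (sS : (s < S.+1)%N), z'); rewrite /= bz' sz'.
- move=> z' bz'; rewrite big_split mulrDl /=; apply: lerD.
    by have := nH z'; rewrite bz' -leNgt.
  rewrite -[X in \sum_(i | _) X]mul1r -mulr_suml.
  apply: le_trans (ler_wpM2r p_ge0 (card_heavy m_gt0 tau0 bz')) _.
  rewrite p_tau; move: (tau ^+ 2) tau0 => T T0.
  rewrite [leLHS](_ : _ = 4 * L * #|supp z'|%:R * expR (- (eps / 2) * l)); last first.
    by field; rewrite gt_eqF.
  rewrite ler_piMr ?mulr_ge0// -[leRHS]expR0 ler_expR.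
  by have := eps_gt0; have := l0; nra.
- move=> j i'; rewrite big_split /=; apply: lerD.
    by have := nF (j, i'); rewrite -leNgt.
  rewrite -[leRHS]np_le -[X in \sum_(i | _) X]mul1r -mulr_suml.
  rewrite -[leLHS]mulr1 ler_pM ?mulr_ge0 ?p_ge0 ?sumr_ge0//; last first.
    by apply: le_trans (expR_ge1Dx _); have := mulr_gt0 eps_gt0 l0; lra.
  apply: ler_wpM2r; first exact: p_ge0.
  rewrite (_ : \sum_(i | _) 1 = #|[pred i | reset n_gt0 j i == i']|%:R) ?ler_nat
    ?card_fiber//.
  by rewrite -sumr_const.
Qed.

End FiniteTensor.

(** * Comparison of the explicit bounds with [Cconst] *)

Section Constants.
Context {R : realType}.

Lemma mul_expRN_le (a x : R) : 0 < a -> x * expR (- a * x) <= a^-1.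
Proof.
move=> a0; rewrite mulNr expRN ler_pdivrMr ?expR_gt0// ler_pdivlMl//.
by apply: le_trans (expR_ge1Dx _); lra.
Qed.

Lemma sqr_mul_expRN_le (a x : R) : 0 < a -> 0 <= x ->
  x ^+ 2 * expR (- (2 * a) * x) <= a^-1 ^+ 2.
Proof.
move=> a0 x0; have -> : x ^+ 2 * expR (- (2 * a) * x) = (x * expR (- a * x)) ^+ 2.
  by rewrite exprMn -expRM_natl; congr (_ * expR _); ring.
rewrite ler_sqr ?nnegrE ?invr_ge0 ?(ltW a0) ?mulr_ge0 ?expR_ge0//.
exact: mul_expRN_le.
Qed.

Lemma up_log_le (n : nat) : (2 <= n)%N -> (up_log 4 n).+1%:R <= 5 * ln (n%:R : R).
Proof.
move=> n2; have lh := ln_nat_ge (R := R) n2.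
suff : (up_log 4 n).-1%:R <= ln (n%:R : R).
  have : (0 < up_log 4 n)%N by rewrite up_log_gt0.
  by case: (up_log 4 n) => // k _ /=; rewrite -!natr1; lra.
have := ltnW (up_log_gtn (isT : (1 < 4)%N) n2).
move: (up_log 4 n).-1 => k kn.
rewrite -ler_expR expR_ln_nat//; apply: (@le_trans _ _ (4 ^ k)%:R); last by rewrite ler_nat.
rewrite -[k%:R]mulr1 expRM_natl natrX lerXn2r ?nnegrE ?expR_ge0//.
have := ln_nat_ge (R := R) (isT : (1 < 2)%N).
rewrite -(ler_expR (1 / 2)) expR_ln_nat// => e2.
have -> : expR 1 = expR (1 / 2) ^+ 2 :> R by rewrite -expRM_natl; congr expR; field.
by have := expR_ge0 (1 / 2 : R); nra.
Qed.

Context (n r : nat) (eps : R).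
Hypotheses (n_ge2 : (2 <= n)%N) (r_ge2 : (2 <= r)%N).
Hypotheses (eps_gt0 : 0 < eps) (eps_lt1 : eps < 1).

Local Notation l := (ln (n%:R : R)).

(** There are at most [5 * l] levels. The exponential decay of the outer terms of [light_bound]
    absorbs the powers of [l]; the middle term is kept as [X], to be bounded according to the regime
    of [Cconst]. *)
Lemma inj_bound_le (L t : R) : 1 <= L -> 0 < t ->
  inj_bound n r eps L t <= 400 * L * (r%:R ^+ 2 / eps +
    r%:R ^+ 2 * (l ^+ 2 * expR (- (eps / 4) * l)) + r%:R * t / eps).
Proof.
move=> L1 t0; have e0 := eps_gt0; have e1 := eps_lt1.
have lh := ln_nat_ge (R := R) n_ge2.
have r2 : 2 <= r%:R :> R by rewrite ler_nat.
rewrite /inj_bound /light_bound /heavy_bound /fiber_bound.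
set X := l ^+ 2 * _.
have X0 : 0 <= X by rewrite mulr_ge0 ?sqr_ge0 ?expR_ge0.
have i1 : 1 <= eps^-1 by rewrite invf_ge1// ltW.
have -> : r%:R * (2 * (8 * L + 6 * r%:R + t + 2) / eps + 4 * L +
    ((2 * L + 2 * r%:R + t + 2) / eps + L)) / 2 =
  eps^-1 * (r%:R * (9 * L + 7 * r%:R + 3 / 2 * t + 3)) + 5 / 2 * (r%:R * L).
  by field; lra.
have -> : 400 * L * (r%:R ^+ 2 / eps + r%:R ^+ 2 * X + r%:R * t / eps) =
  eps^-1 * (400 * L * (r%:R ^+ 2 + r%:R * t)) + 400 * (L * r%:R ^+ 2 * X) by field; lra.
have a1 : l * expR (- (3 / 4 * eps) * l) <= 4 / 3 * eps^-1.
  apply: le_trans (mul_expRN_le _ _) _; first by lra.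
  by rewrite [leLHS](_ : _ = 4 / 3 * eps^-1)//; field; lra.
have a2 : l ^+ 2 * expR (- (1 / 2) * l) <= 16.
  have -> : - (1 / 2) = - (2 * (1 / 4)) :> R by field.
  apply: le_trans (sqr_mul_expRN_le _ _) _; [lra|lra|].
  by rewrite [leLHS](_ : _ = 16)//; field.
have SL : (up_log 4 n).+1%:R * (2 * L * expR (- (3 / 4 * eps) * l)
  + 68 * r%:R ^+ 2 * l * expR (- (eps / 4) * l)
  + 2 * expR (- (1 / 2) * l) * l * (t + 4)) <=
  10 * L * (4 / 3 * eps^-1) + 340 * (r%:R ^+ 2 * X) + 160 * (t + 4).
  apply: (@le_trans _ _ (5 * l * (2 * L * expR (- (3 / 4 * eps) * l)
  + 68 * r%:R ^+ 2 * l * expR (- (eps / 4) * l)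
  + 2 * expR (- (1 / 2) * l) * l * (t + 4)))).
    apply: ler_wpM2r; last exact: up_log_le.
    by rewrite !addr_ge0 ?mulr_ge0 ?expR_ge0 ?exprn_ge0//; lra.
  rewrite [leLHS](_ : _ = 10 * L * (l * expR (- (3 / 4 * eps) * l)) +
     340 * (r%:R ^+ 2 * X) + 10 * (t + 4) * (l ^+ 2 * expR (- (1 / 2) * l)));
       last by rewrite /X; ring.
  rewrite lerD//; first by rewrite lerD// ler_wpM2l//; lra.
  nra.
apply: le_trans (lerD (lerD SL (lexx _)) (lexx _)) _.
have LX : r%:R ^+ 2 * X <= L * r%:R ^+ 2 * X.
  by rewrite -mulrA ler_peMl// mulr_ge0 ?sqr_ge0.
have LX0 : 0 <= r%:R ^+ 2 * X by rewrite mulr_ge0 ?sqr_ge0.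
have Lr : r%:R <= L * r%:R by nra.
have Lr2 : 2 * (L * r%:R) <= L * r%:R ^+ 2 by nra.
have Lt : 2 * t <= L * r%:R * t by nra.
have rt : r%:R * t <= L * r%:R * t by nra.
have rr : r%:R ^+ 2 <= L * r%:R ^+ 2 by nra.
have LL : 2 * L <= L * r%:R by nra.
set q := eps^-1 in i1 *.
have main : 10 * L * (4 / 3) + 160 * (t + 4) + r%:R * (9 * L + 7 * r%:R + 3 / 2 * t + 3)
  + 5 / 2 * (r%:R * L) + 1 <= 400 * L * (r%:R ^+ 2 + r%:R * t) by nra.
have q1 : 160 * (t + 4) + 5 / 2 * (r%:R * L) + 1 <=
   q * (160 * (t + 4) + 5 / 2 * (r%:R * L) + 1).
  by rewrite ler_peMl//; nra.
have q2 := ler_wpM2l (le_trans ler01 i1) main.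
lra.
Qed.

(** In the first regime [r >= 2] gives [10 * ln l <= eps * l] when [ln l > 0], so
    [l ^+ 2 <= n^(eps/5)]. In the second, [r / eps >= 2] makes the squared logarithm at least
    [1 / 4]. *)
Lemma Cconst_cases :
  (Cconst n r eps = r%:R ^+ 4 / eps /\ l ^+ 2 * expR (- (eps / 4) * l) <= 1) \/
  r%:R ^+ 5 / eps ^+ 2 / 4 <= Cconst n r eps.
Proof.
have e0 := eps_gt0; have e1 := eps_lt1; have lh := ln_nat_ge (R := R) n_ge2.
have r2 : 2 <= r%:R :> R by rewrite ler_nat.
rewrite /Cconst; case: ifPn => [rle|_]; [left; split=> // | right].
  (* If [ln l <= 0] the quotient is at most [0] (also for [ln l = 0], where division gives [0]),
     contradicting [r >= 2]. *)
  have [q0|q0] := leP (ln l) 0.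
    suff : eps * l / (5 * ln l) <= 0 by lra.
    by apply: mulr_ge0_le0; [nra|rewrite invr_le0; lra].
  have lE : l = expR (ln l) by rewrite lnK// posrE; lra.
  move: rle; rewrite ler_pdivlMr; last by lra.
  move=> rle; rewrite {1}lE -expRM_natl -expRD -[leRHS]expR0 ler_expR; nra.
have ln2 : 1 / 2 <= ln (r%:R / eps).
  apply: le_trans (ln_nat_ge (R := R) (isT : (1 < 2)%N)) _.
  by rewrite ler_ln ?posrE ?divr_gt0//; [rewrite ler_pdivlMr//; nra|lra].
rewrite ler_wpM2l ?divr_ge0 ?exprn_ge0 ?(ltW e0)//; nra.
Qed.

Lemma inj_bound_le_Cconst (L t : R) : 1 <= L -> 0 < t ->
  inj_bound n r eps L t <= 400 * 33 * L * (Cconst n r eps + r%:R ^+ 3 * t / eps).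
Proof.
move=> L1 t0; have e0 := eps_gt0; have e1 := eps_lt1; have lh := ln_nat_ge (R := R) n_ge2.
have r2 : 2 <= r%:R :> R by rewrite ler_nat.
apply: le_trans (inj_bound_le L1 t0) _.
have i1 : 1 <= eps^-1 by rewrite invf_ge1// ltW.
suff h : r%:R ^+ 2 / eps + r%:R ^+ 2 * (l ^+ 2 * expR (- (eps / 4) * l)) <= 33 * Cconst
  n r eps.
  have tr : r%:R * t / eps <= r%:R ^+ 3 * t / eps.
    apply: ler_wpM2r; first by rewrite invr_ge0 ltW.
    by apply: ler_wpM2r; [exact: ltW|nra].
  have tr0 : 0 <= r%:R ^+ 3 * t / eps by rewrite !mulr_ge0 ?invr_ge0 ?exprn_ge0//; lra.
  have := lerD h tr; nra.
have rs : 4 <= r%:R ^+ 2 :> R by nra.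
have rr : 4 * r%:R ^+ 2 <= r%:R ^+ 4 :> R by rewrite (exprD _ 2 2); nra.
have rr5 : 8 * r%:R ^+ 2 <= r%:R ^+ 5 :> R by rewrite (exprS _ 4); nra.
case: Cconst_cases => [[-> X1]|C5].
  have q1 : r%:R ^+ 2 * (l ^+ 2 * expR (- (eps / 4) * l)) <= r%:R ^+ 2 * 1.
    by rewrite ler_wpM2l ?sqr_ge0.
  have q2 : r%:R ^+ 2 <= r%:R ^+ 2 * eps^-1 by rewrite ler_peMr ?sqr_ge0.
  have q3 : 4 * r%:R ^+ 2 * eps^-1 <= r%:R ^+ 4 * eps^-1 by rewrite ler_wpM2r//
    invr_ge0 ltW.
  have q4 : 0 <= r%:R ^+ 2 * eps^-1 by rewrite mulr_ge0 ?sqr_ge0 ?invr_ge0 ?ltW.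
  by lra.
(* The left side is at most [65 * r ^+ 2 / eps ^+ 2], hence at most [65 / 8 * r ^+ 5 / eps ^+ 2],
   and [65 / 8 <= 33 / 4]. *)
apply: le_trans (_ : 33 * (r%:R ^+ 5 / eps ^+ 2 / 4) <= _); last by lra.
have X64 : l ^+ 2 * expR (- (eps / 4) * l) <= 64 * eps^-1 ^+ 2.
  have -> : eps / 4 = 2 * (eps / 8) by field.
  apply: le_trans (sqr_mul_expRN_le _ _) _; [lra|lra|].
  by rewrite [leLHS](_ : _ = 64 * eps^-1 ^+ 2)//; field; lra.
rewrite -exprVn; move: (eps^-1) i1 X64 => q i1 X64.
have q1 : r%:R ^+ 2 * (l ^+ 2 * expR (- (eps / 4) * l)) <= r%:R ^+ 2 * (64 * q ^+ 2).
  by rewrite ler_wpM2l ?sqr_ge0.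
have q2 : r%:R ^+ 2 * q <= r%:R ^+ 2 * q ^+ 2 by rewrite ler_wpM2l ?sqr_ge0//; nra.
have q3 : 8 * r%:R ^+ 2 * q ^+ 2 <= r%:R ^+ 5 * q ^+ 2 by rewrite ler_wpM2r ?sqr_ge0.
have q4 : 0 <= r%:R ^+ 2 * q ^+ 2 by rewrite mulr_ge0 ?sqr_ge0.
lra.
Qed.

Lemma Cconst_ge_cube : r%:R ^+ 3 / eps <= Cconst n r eps.
Proof.
have e0 := eps_gt0; have e1 := eps_lt1.
have r2 : 2 <= r%:R :> R by rewrite ler_nat.
have i1 : 1 <= eps^-1 by rewrite invf_ge1// ltW.
have r3 : 0 <= r%:R ^+ 3 :> R by rewrite exprn_ge0.
case: Cconst_cases => [[-> _]|C5].
  by rewrite ler_wpM2r ?invr_ge0 ?(ltW e0)// [leRHS]exprS; nra.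
apply: le_trans C5; rewrite -exprVn; move: (eps^-1) i1 => q i1.
have q1 : r%:R ^+ 3 * q <= r%:R ^+ 3 * q ^+ 2 by rewrite ler_wpM2l//; nra.
have q3 : 4 * r%:R ^+ 3 * q ^+ 2 <= r%:R ^+ 5 * q ^+ 2.
  apply: ler_wpM2r; first exact: sqr_ge0.
  by rewrite (exprD _ 2 3); apply: ler_wpM2r => //; nra.
have q4 : 0 <= r%:R ^+ 3 * q ^+ 2 by rewrite mulr_ge0 ?sqr_ge0.
lra.
Qed.

Lemma Cconst_ge1 : 1 <= Cconst n r eps.
Proof.
apply: le_trans Cconst_ge_cube; have e0 := eps_gt0; have e1 := eps_lt1.
have r2 : 2 <= r%:R :> R by rewrite ler_nat.
rewrite ler_pdivlMr// mul1r; apply: le_trans (ltW e1) _.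
by rewrite exprn_ege1//; lra.
Qed.

End Constants.

(** * From tail to mean for finitely valued entries *)

Section FiniteTailMean.
Context {R : realType} (n r : nat) (eps L : R).
Hypotheses (n_ge2 : (2 <= n)%N) (r_ge2 : (2 <= r)%N).
Hypotheses (eps_gt0 : 0 < eps) (eps_lt1 : eps < 1) (L_ge1 : 1 <= L).
Context (V : finType) (mu : tensor_index n r -> V -> R) (val : V -> R).
Hypothesis mu_ge0 : forall i v, 0 <= mu i v.
Hypothesis mu_sum : forall i, \sum_v mu i v = 1.
Hypothesis mu_p : forall i, \sum_(v | val v != 0) mu i v <= L * n%:R `^ (- 1 - eps).
Hypothesis val_le1 : forall v, `|val v| <= 1.

Local Notation dev f := (fun i => val (f i) - fmean (mu i) val).

Lemma finite_tail t : 0 < t ->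
  prod_prob mu (fun f =>
    400 * 33 * L * (Cconst n r eps + r%:R ^+ 3 * t / eps) < inj_norm (dev f))
  <= n%:R `^ (- t).
Proof.
move=> t0; have powE a : n%:R `^ a = expR (a * ln n%:R) :> R.
  by rewrite /powR pnatr_eq0 gtn_eqF// ltnW.
have mu_p' i : \sum_(v | val v != 0) mu i v <= L * expR (- (1 + eps) * ln n%:R).
  by have := mu_p i; rewrite powE opprD.
rewrite powE; apply: le_trans (finite_tail_raw n_ge2 r_ge2 eps_gt0 eps_lt1 L_ge1 t0
  mu_ge0 mu_sum mu_p' val_le1).
apply: prod_prob_le => // f; apply: le_lt_trans.
exact: inj_bound_le_Cconst.
Qed.

(** A discrete layer cake: beyond [a + b], each further step of length [b] is paid for by a
    threshold already passed. *)
Lemma le_sum_steps (a b x : R) (K : nat) : 0 <= b -> x <= a + b * K.+1%:R ->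
  x <= a + b + b * \sum_(k < K) (a + b * k.+1%:R < x)%R%:R.
Proof.
move=> b0; elim: K => [|K IH] xK; first by rewrite big_ord0 mulr0 addr0 -[b in leRHS]mulr1.
rewrite big_ord_recr /=; have [xle|xgt] := leP x (a + b * K.+1%:R).
  by rewrite addr0 IH.
rewrite (eq_bigr (fun=> 1)) => [|k _].
  by rewrite sumr_const card_ord; move: xK; rewrite -!natr1; lra.
rewrite (le_lt_trans _ xgt)// lerD2l ler_wpM2l// ler_nat ltnS ltnW//.
Qed.

(** Raising [t] by one raises the threshold by [b], and the tails are at most [2^-1 ^+ k.+1]. They
    sum to at most 1, which leaves [a + 2 * b <= 3 * a]. *)
Lemma finite_mean :
  \sum_f prod_weight mu f * inj_norm (dev f) <= 3 * (400 * 33) * L * Cconst n r eps.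
Proof.
pose a := 400 * 33 * L * Cconst n r eps; pose b := 400 * 33 * L * (r%:R ^+ 3 / eps).
have L0 : 0 < L by apply: lt_le_trans L_ge1.
have b0 : 0 < b.
  by rewrite /b !mulr_gt0 ?invr_gt0 ?exprn_gt0 ?ltr0n// ltnW.
have ba : b <= a.
  by rewrite ler_wpM2l ?mulr_ge0 ?(ltW L0)//; exact: Cconst_ge_cube.
(* There are finitely many samples, so finitely many steps suffice; the sum of all the norms is a
   common bound. *)
have [K HK] : exists K : nat, forall f : {ffun tensor_index n r -> V}, inj_norm (dev f)
  <= a + b * K.+1%:R.
  pose B := \sum_(f : {ffun tensor_index n r -> V}) inj_norm (dev f);
    exists (Num.truncn (B / b)) => f.
  apply: (@le_trans _ _ B).
    rewrite /B (bigD1 f)//= lerDl; apply: sumr_ge0 => g _; apply: inj_norm_ge0.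
    exact: ltnW.
  have := truncnS_gt (B / b); rewrite ltr_pdivrMr// mulrC => /ltW.
  have : 0 <= a by apply: le_trans ba; exact: ltW.
  lra.
have W1 : \sum_f prod_weight mu f = 1.
  by rewrite -(bigA_distr_bigA mu) big1.
apply: (@le_trans _ _ (\sum_f prod_weight mu f *
   (a + b + b * \sum_(k < K) (a + b * k.+1%:R < inj_norm (dev f))%R%:R))).
  apply: ler_sum => f _; rewrite ler_wpM2l ?prod_weight_ge0//.
  by apply: le_sum_steps; [exact: ltW|exact: HK].
have -> : \sum_f prod_weight mu f *
   (a + b + b * \sum_(k < K) (a + b * k.+1%:R < inj_norm (dev f))%R%:R) =
  a + b + b * \sum_(k < K) prod_prob mu (fun f => a + b * k.+1%:R < inj_norm (dev f)).
  under eq_bigr do rewrite mulrDr mulrCA mulr_sumr.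
  rewrite big_split /= -mulr_suml W1 mul1r -mulr_sumr exchange_big /=; congr (_ + _ * _).
  apply: eq_bigr => k _; rewrite /prod_prob [RHS]big_mkcond; apply: eq_bigr => f _.
  by case: ifP; rewrite ?mulr1 ?mulr0.
suff : \sum_(k < K) prod_prob mu (fun f => a + b * k.+1%:R < inj_norm (dev f)) <= 1.
  move=> s1; apply: le_trans (lerD (lexx _) (ler_wpM2l (ltW b0) s1)) _.
  have : 3 * a = 3 * (400 * 33) * L * Cconst n r eps by rewrite /a; ring.
  lra.
apply: (@le_trans _ _ (\sum_(k < K) 2^-1 ^+ k.+1)).
  apply: ler_sum => k _; apply: (@le_trans _ _ (n%:R `^ (- k.+1%:R))).
    apply: le_trans (finite_tail (ltr0Sn _ k)).
    apply: prod_prob_le => // f; apply: le_lt_trans; rewrite /a /b.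
    by rewrite le_eqVlt; apply/orP; left; apply/eqP; ring.
  rewrite powRN powR_mulrn// -exprVn lerXn2r ?nnegrE ?invr_ge0//.
  by rewrite lef_pV2 ?posrE ?ltr0n ?ler_nat// ltnW.
suff : \sum_(k < K) 2^-1 ^+ k.+1 = 1 - 2^-1 ^+ K :> R.
  by move=> ->; rewrite gerBl exprn_ge0.
elim: (K) => [|k IH]; first by rewrite big_ord0 expr0 subrr.
by rewrite big_ord_recr /= IH exprS; field.
Qed.

End FiniteTailMean.

Local Open Scope classical_set_scope.
Local Open Scope ring_scope.

(** * Rounding a random tensor to finitely many values *)

Section FiniteValued.
Context {d : measure_display} {Omega : measurableType d} {R : realType}.
Variable P : probability Omega R.
Context (F : finType) (g : Omega -> F).
Hypothesis mg : forall v, measurable (g @^-1` [set v]).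

Lemma finite_valued_eventE (Q : pred F) :
  [set w | Q (g w)] = \big[setU/set0]_(v | Q v) (g @^-1` [set v]).
Proof.
rewrite -(bigcup_pred Q); apply/seteqP; split => [w Qw|w [v Qv] gv]; first by exists (g w).
by rewrite /= gv.
Qed.

Lemma measurable_finite_valued (Q : pred F) : measurable [set w | Q (g w)].
Proof. by rewrite finite_valued_eventE; exact: bigsetU_measurable. Qed.

Lemma measurable_fun_finite_valued (phi : F -> R) :
  measurable_fun setT (fun w => phi (g w)).
Proof.
move=> _ B _; rewrite setTI.
have -> : (fun w => phi (g w)) @^-1` B = [set w | `[< B (phi (g w)) >]].
  by apply/seteqP; split => w /asboolP.
exact: (measurable_finite_valued (fun v => `[< B (phi v) >])).
Qed.

Lemma integral_finite_valued (phi : F -> R) :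
  (\int[P]_w (phi (g w))%:E = \sum_v (phi v)%:E * P (g @^-1` [set v]))%E.
Proof.
have iI v : P.-integrable setT (EFin \o \1_(g @^-1` [set v])).
  exact: (integrable_indic P (mg v)).
transitivity (\int[P]_w (\sum_v (phi v)%:E * (\1_(g @^-1` [set v]) w)%:E))%E.
  apply: eq_integral => w _; rewrite (bigD1 (g w))//= big1 ?adde0.
    by rewrite indicE mem_set// mule1.
  by move=> v vw; rewrite indicE memNset ?mule0//= => gw; rewrite gw eqxx in vw.
rewrite integral_sum => [|//|v]; last by apply: integrableZl => //; exact: iI.
apply: eq_bigr => v _; rewrite integralZl; [|exact: measurableT|exact: iI].
by rewrite integral_indic// setIT.
Qed.

Lemma prob_finite_valued (Q : pred F) :
  (P [set w | Q (g w)] = \sum_(v | Q v) P (g @^-1` [set v]))%E.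
Proof.
have mQ := measurable_finite_valued Q.
transitivity (\int[P]_w ((Q (g w))%:R : R)%:E)%E.
  rewrite -[X in P X]setIT -integral_indic//; apply: eq_integral => w _.
  by rewrite indicE; congr ((nat_of_bool _)%:R%:E); apply/idP/idP => [/set_mem|/mem_set].
rewrite (integral_finite_valued (fun v => (Q v)%:R)) [RHS]big_mkcond /=.
by apply: eq_bigr => v _; case: (Q v); rewrite ?mul1e ?mul0e.
Qed.

End FiniteValued.

(** Every simple function below [f1] is below [f2], so the suprema defining the integrals compare
    for arbitrary nonnegative functions. *)
Lemma le_integral_ge0 {d : measure_display} {T : measurableType d} {R : realType}
    (mu : {measure set T -> \bar R}) (f1 f2 : T -> \bar R) :
  (forall x, 0 <= f1 x)%E -> (forall x, f1 x <= f2 x)%E ->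
  (\int[mu]_x f1 x <= \int[mu]_x f2 x)%E.
Proof.
move=> f10 f12; have f20 x : (0 <= f2 x)%E by apply: le_trans (f12 x).
rewrite !ge0_integralTE//; apply: ereal_sup_le => _ [h hf <-].
by exists h => // x; apply: le_trans (f12 x).
Qed.

(** * Consequences of independence *)

Section Independence.
Context {d : measure_display} {Omega : measurableType d} {R : realType}.
Variable P : probability Omega R.
Context (I : finType) (X : I -> {RV P >-> R}).
Hypothesis indepX : mutually_independent X.

Lemma measurable_RV_preimage i (A : set R) : measurable A -> measurable (X i @^-1` A).
Proof. by move=> mA; rewrite -[_ @^-1` _]setTI; exact: measurable_funP. Qed.

Lemma independent_all (A : I -> set R) : (forall i, measurable (A i)) ->
  (P [set w | forall i, A i (X i w)] = \prod_i P (X i @^-1` A i))%E.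
Proof.
move=> mA; have := indepX [set: I]%SET mA.
under [in RHS]eq_bigl do rewrite inE.
by move=> <-; congr (P _); apply/seteqP; split => w /= h i; [move=> _;
  exact: h|apply: h; rewrite /= inE].
Qed.

Lemma measurable_forall (A : I -> set R) : (forall i, measurable (A i)) ->
  measurable [set w | forall i, A i (X i w)].
Proof.
move=> mA; have -> : [set w | forall i, A i (X i w)] = \bigcap_(i in [set: I]) (X i
  @^-1` A i).
  by apply/seteqP; split => w h i; [move=> _; exact: h|exact: (h i Logic.I)].
apply: fin_bigcap_measurable => [|i _]; first exact: finite_finset.
exact: measurable_RV_preimage.
Qed.

Definition others (i : I) (B : set R) : set Omega :=
  [set w | forall k, k != i -> B (X k w)].

Lemma othersE i B : others i B =
  [set w | forall k, (if k == i then setT else B) (X k w)].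
Proof.
apply/seteqP; split => w /= h k; first by case: eqVneq => // ki; exact: h.
by move=> ki; have := h k; rewrite (negbTE ki).
Qed.

Lemma measurable_others i B : measurable B -> measurable (others i B).
Proof.
move=> mB; rewrite othersE.
by apply: (measurable_forall (A := fun k => if k == i then setT else B)) => k; case: ifP.
Qed.

Lemma independent_others i (A B : set R) : measurable A -> measurable B ->
  (P ((X i @^-1` A) `&` others i B) = P (others i B) * P (X i @^-1` A))%E.
Proof.
move=> mA mB; pose A' k := if k == i then A else B.
have -> : (X i @^-1` A) `&` others i B = [set w | forall k, A' k (X k w)].
  apply/seteqP; split => w /=.
    by move=> [Ai h] k; rewrite /A'; case: eqVneq => [->//|ki]; exact: h.
  move=> h; split; first by have := h i; rewrite /A' eqxx.
  by move=> k ki; have := h k; rewrite /A' (negbTE ki).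
rewrite independent_all; last by move=> k; rewrite /A'; case: ifP.
rewrite othersE (independent_all (A := fun k => if k == i then setT else B));
  last by move=> k; case: ifP.
rewrite (bigD1 i)//= [in RHS](bigD1 i)//= /A' eqxx preimage_setT probability_setT mul1e
  muleC.
by congr (_ * _)%E; apply: eq_bigr => k /negbTE ->.
Qed.

(** By independence, restricting [P] to [others i B] before pushing forward along [X i] only
    rescales the image measure by [P (others i B)]. *)
Lemma integral_others i (B : set R) (f : R -> R) :
  measurable B -> measurable_fun setT f -> (forall x, 0 <= f x) ->
  (\int[P]_(w in others i B) (f (X i w))%:E =
   P (others i B) * \int[P]_w (f (X i w))%:E)%E.
Proof.
move=> mB mf f0; have mC := measurable_others i mB.
have mfE : measurable_fun setT (EFin \o f) by apply/measurable_EFinP.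
have mX : measurable_fun setT (X i) by exact: measurable_funP.
pose c : {nonneg R} := NngNum (fine_ge0 (measure_ge0 P (others i B))).
have mfX : measurable_fun setT (fun w => (f (X i w))%:E) by exact: measurableT_comp mfE mX.
have e1 := ge0_integral_pushforward mX (mrestr P mC) measurableT mfE (fun y _ => f0 y).
have e2 := ge0_integral_pushforward mX P measurableT mfE (fun y _ => f0 y).
rewrite preimage_setT in e1; rewrite preimage_setT in e2.
transitivity (\int[mrestr P mC]_w (f (X i w))%:E)%E.
  rewrite -[in RHS](setvU (others i B)) setUC ge0_integral_setU//.
  - rewrite [X in (_ + X)%E]null_set_integral ?adde0//.
    + by apply: eq_measure_integral => A mA sAC; rewrite /= /mrestr (setIidl sAC).
    + exact: measurableC.
    + by apply: measurable_funS mfX.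
    + by rewrite /= /mrestr setICl measure0.
  - exact: measurableC.
  - by apply: measurable_funS mfX.
  - by move=> w _; rewrite lee_fin.
  - by apply/disj_setPS => w [].
rewrite -[LHS]e1 (eq_measure_integral (mscale c (pushforward P (X i)))).
  rewrite ge0_integral_mscale// ?e2//=; last by move=> x _; rewrite lee_fin.
  by rewrite fineK// fin_num_measure.
move=> A mA _; rewrite /= /mscale /mrestr /pushforward /= independent_others//.
by rewrite fineK// fin_num_measure.
Qed.

End Independence.

(** * First moment of the large entries *)

Section LargeEntries.
Context {d : measure_display} {Omega : measurableType d} {R : realType}.
Variable P : probability Omega R.
Context (n r : nat) (T : tensor_index n r -> {RV P >-> R}).

Local Notation N w := (tensor_sup_norm (sample T w)).

Lemma le_sup_norm w i : `|T i w| <= N w.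
Proof. by rewrite /tensor_sup_norm (bigD1 i)//= le_max lexx. Qed.

Lemma sup_norm_ge0 w : 0 <= N w.
Proof. by rewrite /tensor_sup_norm; elim/big_ind: _ => // x y x0 y0; rewrite le_max x0. Qed.

Lemma sup_norm_le w (c : R) : 0 <= c -> (forall i, `|T i w| <= c) -> N w <= c.
Proof.
move=> c0 Tc; rewrite /tensor_sup_norm; elim/big_ind: _ => [//|x y xc yc|i _ //].
  by rewrite ge_max xc yc.
exact: Tc.
Qed.

Lemma sup_norm_le_sum w : N w <= \sum_i `|T i w|.
Proof.
apply: sup_norm_le => [|i]; first exact: sumr_ge0.
by rewrite (bigD1 i)//= lerDl sumr_ge0.
Qed.

Lemma measurable_sup_norm : measurable_fun setT (fun w => N w).
Proof.
rewrite /tensor_sup_norm /sample; elim: (index_enum _) => [|i s IH].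
  by under eq_fun do rewrite big_nil; exact: measurable_cst.
under eq_fun do rewrite big_cons.
apply: measurable_maxr => //; apply: measurableT_comp => //.
Qed.

Context (M : R).
Hypothesis M_gt0 : 0 < M.
Hypothesis indepT : mutually_independent T.
Hypothesis EM : (2%:E * \int[P]_w (N w)%:E <= M%:E)%E.

Definition excess (x : R) : R := if M < `|x| then `|x| else 0.

Lemma excess_ge0 x : 0 <= excess x.
Proof. by rewrite /excess; case: ifP. Qed.

Lemma measurable_excess : measurable_fun setT excess.
Proof.
apply: measurable_fun_ifT => //; first exact: measurable_fun_ltr.
Qed.

Let ball := [set x : R | `|x| <= M].

Let mball : measurable ball.
Proof.
rewrite (_ : ball = `[- M, M]%classic) //.
by apply/seteqP; split => x; rewrite /ball /= in_itv /= ler_norml.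
Qed.

Lemma measurable_gt_set (f : Omega -> R) (a : R) : measurable_fun setT f ->
  measurable [set w | a < f w].
Proof.
move=> mf; have := mf measurableT _ (measurable_itv `]a, +oo[).
by rewrite setTI preimage_itvoy.
Qed.

Lemma all_smallE : [set w | forall i, ball (T i w)] = ~` [set w | M < N w].
Proof.
apply/seteqP; split => w /= h.
  by apply/negP; rewrite -leNgt; apply: sup_norm_le => //; exact: ltW.
move=> i; apply: le_trans (le_sup_norm w i) _; rewrite leNgt; exact/negP.
Qed.

(** Markov's inequality, as [M] is at least twice the mean of the sup norm. *)
Lemma prob_all_small : (2^-1%:E <= P [set w | forall i, ball (T i w)])%E.
Proof.
have mN := measurable_gt_set M measurable_sup_norm.
have h : (M%:E * P [set w | (M < N w)%R] <= \int[P]_w (N w)%:E)%E.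
  rewrite -[X in P X]setIT -(integral_indic P measurableT mN) -ge0_integralZl//.
  - apply: le_integral_ge0 => w.
      by rewrite -EFinM lee_fin mulr_ge0// ltW.
    rewrite -EFinM lee_fin indicE; case: (boolP (_ \in _)) => [/set_mem/= Mw|_].
      by rewrite mulr1 ltW.
    by rewrite mulr0 sup_norm_ge0.
  - by apply/measurable_EFinP; exact: measurable_indic.
  - by rewrite lee_fin ltW.
rewrite all_smallE probability_setC//.
have := le_trans (lee_wpmul2l _ h) EM; rewrite -(fineK (fin_num_measure P _ mN)).
rewrite -!EFinM -EFinB !lee_fin => /(_ (ler0n R 2)).
by have := M_gt0; nra.
Qed.

Lemma prob_others_small i : (2^-1%:E <= P (others T i ball))%E.
Proof.
apply: le_trans prob_all_small _; apply: le_measure; rewrite ?inE.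
- exact: (measurable_forall T (fun=> mball)).
- exact: measurable_others.
- by move=> w h k _; exact: h.
Qed.

(** At most one entry can be large while all its companions are small, so the excesses restricted to
    these events sum to at most the sup norm. By independence each restriction costs a factor of at
    least [1 / 2]. *)
Lemma sum_excess : (\sum_i \int[P]_w (excess (T i w))%:E <= M%:E)%E.
Proof.
apply: le_trans EM.
have mX i : measurable_fun setT (fun w => (excess (T i w))%:E).
  by apply/measurable_EFinP; apply: measurableT_comp => //; exact: measurable_excess.
have mI i : measurable (others T i ball) by exact: measurable_others.
apply: (@le_trans _ _ (2%:E * \sum_i \int[P]_(w in others T i ball) (excess (T i w))%:E)%E).
  rewrite ge0_sume_distrr; last first.
    by move=> i _; apply: integral_ge0 => w _; rewrite lee_fin excess_ge0.
  apply: lee_sum => i _; rewrite integral_others//; [|exact: measurable_excess|exact: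
    excess_ge0].
  rewrite muleA -[leLHS]mul1e lee_wpmul2r//.
    by apply: integral_ge0 => w _; rewrite lee_fin excess_ge0.
  have := lee_wpmul2l (_ : 0 <= 2%:E)%E (prob_others_small i).
  by rewrite -EFinM mulfV// lee_fin; apply.
apply: lee_wpmul2l => //.
under eq_bigr do rewrite integral_mkcond.
rewrite -ge0_integral_sum//.
- apply: le_integral_ge0 => w.
    by apply: sume_ge0 => i _; apply: erestrict_ge0 => v _; rewrite lee_fin excess_ge0.
  have patchE i : ((fun v => (excess (T i v))%:E) \_ (others T i ball)) w =
      (if w \in others T i ball then excess (T i w) else 0)%:E.
    by rewrite patchE; case: ifP.
  under eq_bigr do rewrite patchE.
  rewrite sumEFin lee_fin.
  case: (boolP [exists i, (w \in others T i ball) && (M < `|T i w|)]).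
    move=> /existsP[i /andP[/set_mem wi Mi]].
    rewrite (bigD1 i)//= mem_set// /excess Mi big1 ?addr0 ?le_sup_norm// => k ki.
    by rewrite ltNge (wi k ki) /=; case: ifP.
  rewrite negb_exists => /forallP h; rewrite big1 ?sup_norm_ge0// => i _.
  case: ifPn => // wi; have := h i; rewrite wi /= => nM.
  by rewrite /excess (negbTE nM).
- by move=> i; apply/(measurable_restrictT _ (mI i)); exact: measurable_funS (mX i).
- by move=> i w _; apply: erestrict_ge0 => v _; rewrite lee_fin excess_ge0.
Qed.

End LargeEntries.

(** Grid tuples give lower bounds that approach the norm, so the event is a countable union, over
    all resolutions, of events about linear forms in the entries. *)
Lemma measurable_inj_norm_gt {d : measure_display} {Omega : measurableType d}
    {R : realType} (P : probability Omega R) (n r : nat)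
    (T : tensor_index n r -> {RV P >-> R}) (c : R) : (0 < n)%N ->
  measurable [set w | c < inj_norm (centered T w)].
Proof.
move=> n0.
pose S k (z : grid n r k.+1) : set Omega :=
  if in_ball z then [set w | c < `|\sum_i centered T w i * coef z i|] else set0.
have -> : [set w | c < inj_norm (centered T w)] =
    \bigcup_k \bigcup_(z in [set: grid n r k.+1]) S k z.
  apply/seteqP; split => w /=; last first.
    move=> [k _ [z _]]; rewrite /S; case: ifP => // bz /= cz.
    by apply: lt_le_trans cz _; exact: le_inj_norm_grid.
  move=> cinj; pose A : R := \sum_i `|centered T w i|.
  (* This resolution makes the rounding error [A * r / k.+1] smaller than the gap to [c]. *)
  pose k := Num.truncn (A * r%:R / (inj_norm (centered T w) - c)).
  have [z bz hz] := inj_norm_grid n0 (centered T w) (ltn0Sn k).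
  exists k => //; exists z => //; rewrite /S bz /=.
  have := truncnS_gt (A * r%:R / (inj_norm (centered T w) - c)).
  rewrite ltr_pdivrMr ?subr_gt0// -/k [ltRHS]mulrC -ltr_pdivrMr ?ltr0n// => hk.
  move: hk; rewrite ltrBrDl => hk; rewrite -/A mulrA in hz.
  by have := lt_le_trans hk hz; rewrite ltrD2r.
apply: bigcup_measurable => k _; apply: fin_bigcup_measurable => [|z _];
  first exact: finite_finset.
rewrite /S; case: ifP => // _; apply: measurable_gt_set.
apply: measurableT_comp => //; apply: measurable_sum => i.
by apply: measurable_funM => //; exact: measurable_funB.
Qed.

(** * Rounding a real number to a grid on [[- M, M]] *)

Section Quantization.
Context {R : realType} (M : R) (D : nat).
Hypotheses (M_gt0 : 0 < M) (D_gt0 : (0 < D)%N).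

(** Both zero and the entries beyond [M] are sent to zero, so rounding preserves sparsity. *)
Definition quantize (x : R) : 'I_(2 * D).+1 :=
  if `|x| <= M then round0 D (x / M) else gzero D.

Lemma quantize_err x : `|x - M * gval (quantize x)| <= M / D%:R + excess M x.
Proof.
rewrite /quantize /excess [`|x| <= M]leNgt; case: (ltP M `|x|) => xM /=.
  have /eqP -> : gval (gzero D) == 0 :> R by rewrite gval_eq0// mag_gzero.
  by rewrite mulr0 subr0 lerDr divr_ge0// ltW.
have xM1 : `|x / M| <= 1 by rewrite normrM normfV (gtr0_norm M_gt0) ler_pdivrMr// mul1r.
have [_ h] := round0_spec D_gt0 xM1.
rewrite addr0 -{1}[x](mulfVK (lt0r_neq0 M_gt0)) mulrC -mulrBr normrM (gtr0_norm M_gt0).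
by rewrite mulrC [leRHS]mulrC ler_pM2r// mulrC.
Qed.

Lemma quantize0 : gval (quantize 0) = 0 :> R.
Proof.
have h0 : `|0 / M| <= 1 by rewrite mul0r normr0.
have [h _] := round0_spec D_gt0 h0; apply/eqP; rewrite -normr_le0 /quantize normr0 (ltW
  M_gt0).
by apply: le_trans h _; rewrite mul0r normr0.
Qed.

(** Rounding is monotone, so the preimage inside [[- M, M]] is an interval. Outside it is empty or
    everything. *)
Lemma measurable_quantize v : measurable (quantize @^-1` [set v]).
Proof.
pose A := [set x : R | `|x| <= M /\ round0 D (x / M) = v].
pose B := [set x : R | M < `|x| /\ gzero D = v].
have -> : quantize @^-1` [set v] = A `|` B.
  apply/seteqP; split => x; rewrite /A /B /= /quantize.
    by case: leP => xM h; [left|right].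
  by case=> [[-> //]|[]]; rewrite leNgt => ->.
apply: measurableU.
  apply: is_interval_measurable => x y [xM xv] [yM yv] z /andP[xz zy].
  have zM : `|z| <= M.
    by move: xM yM; rewrite !ler_norml => /andP[x1 x2] /andP[y1 y2]; apply/andP; split; lra.
  split => //; apply/val_inj/eqP; rewrite eqn_leq; apply/andP.
  have nM u : `|u| <= M -> `|u / M| <= 1.
    by move=> uM; rewrite normrM normfV (gtr0_norm M_gt0) ler_pdivrMr// mul1r.
  by split; [rewrite -yv|rewrite -xv]; apply: round0_mono => //;
    rewrite ?nM// ler_pM2r ?invr_gt0.
have [gv|gv] := pselect (gzero D = v); last by rewrite (_ : B = set0)//; apply/seteqP;
  split => x // [].
have -> : B = [set x : R | M < `|x|] by apply/seteqP; split => x; [case|split].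
have mn : measurable_fun setT (fun x : R => `|x|) by exact: normr_measurable.
by have := mn measurableT _ (measurable_itv `]M, +oo[); rewrite setTI preimage_itvoy.
Qed.

End Quantization.

(** * Transfer from the rounded tensor to the original one *)

Section Transfer.
Context {d : measure_display} {Omega : measurableType d} {R : realType}.
Variable P : probability Omega R.
Context (n r : nat) (eps L M : R) (T : tensor_index n r -> {RV P >-> R}).
Hypotheses (n_ge2 : (2 <= n)%N) (r_ge2 : (2 <= r)%N).
Hypotheses (eps_gt0 : 0 < eps) (eps_lt1 : eps < 1) (L_ge1 : 1 <= L).
Hypothesis indepT : mutually_independent T.
Hypothesis intT : forall i, P.-integrable [set: Omega] (EFin \o T i).
Hypothesis sparseT : forall i,
  (P [set w | T i w <> 0%R] <= (L * n%:R `^ (- 1 - eps))%:E)%E.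
Hypothesis M_gt0 : 0 < M.
Hypothesis EM :
  (2%:E * \int[P]_w (tensor_sup_norm (sample T w))%:E <= M%:E)%E.

(** With this resolution the [n ^ r] rounding errors [M / D] add up to [M / 2]. *)
Local Notation D := (2 * n ^ r)%N.
Let n_gt0 : (0 < n)%N. Proof. exact: ltnW. Qed.
Let D_gt0 : (0 < D)%N. Proof. by rewrite muln_gt0 expn_gt0 n_gt0. Qed.

Definition qentry i (w : Omega) : 'I_(2 * D).+1 := quantize M D (T i w).

Definition qsample (w : Omega) : {ffun tensor_index n r -> 'I_(2 * D).+1} :=
  [ffun i => qentry i w].

Definition qlaw i (v : 'I_(2 * D).+1) : R := fine (P (qentry i @^-1` [set v])).

Let qval : 'I_(2 * D).+1 -> R := @gval R D.

Lemma measurable_qentry i v : measurable (qentry i @^-1` [set v]).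
Proof.
exact: (measurable_RV_preimage T i (measurable_quantize M_gt0 D_gt0 v)).
Qed.

Lemma qsample_preimage f : qsample @^-1` [set f] =
  [set w | forall i, (quantize M D @^-1` [set f i]) (T i w)].
Proof.
apply/seteqP; split => w /= => [<- i|h]; first by rewrite ffunE.
by apply/ffunP => i; rewrite ffunE; exact: h.
Qed.

Lemma measurable_qsample f : measurable (qsample @^-1` [set f]).
Proof.
by rewrite qsample_preimage; exact: (measurable_forall T (fun i => measurable_quantize
  M_gt0 D_gt0 (f i))).
Qed.

Lemma qlawE i v : (qlaw i v)%:E = P (qentry i @^-1` [set v]).
Proof. by rewrite fineK// fin_num_measure//; exact: measurable_qentry. Qed.

Lemma qlaw_ge0 i v : 0 <= qlaw i v.
Proof. by rewrite fine_ge0. Qed.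

Lemma qlaw_event i (Q : pred 'I_(2 * D).+1) :
  (\sum_(v | Q v) qlaw i v)%:E = P [set w | Q (qentry i w)].
Proof.
rewrite (prob_finite_valued P (measurable_qentry i)) -sumEFin.
by apply: eq_bigr => v _; rewrite qlawE.
Qed.

Lemma qlaw_sum i : \sum_v qlaw i v = 1.
Proof.
apply: EFin_inj; rewrite (qlaw_event i xpredT).
by rewrite (_ : [set w | _] = setT) ?probability_setT//; apply/seteqP.
Qed.

Lemma qlaw_sparse i :
  \sum_(v | qval v != 0) qlaw i v <= L * n%:R `^ (- 1 - eps).
Proof.
rewrite -lee_fin; apply: le_trans (sparseT i).
rewrite (qlaw_event i (fun v => qval v != 0)).
have m0 : measurable [set w | T i w <> 0%R].
  rewrite (_ : [set w | _] = T i @^-1` (~` [set 0])); last by [].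
  apply: measurable_RV_preimage; exact: measurableC.
apply: le_measure; rewrite ?inE//.
  exact: (measurable_finite_valued (measurable_qentry i) (fun v => qval v != 0)).
move=> w /= /eqP qw Tw; apply: qw.
by rewrite /qentry Tw; exact: quantize0.
Qed.

Lemma qsample_weight f :
  P (qsample @^-1` [set f]) = (prod_weight qlaw f)%:E.
Proof.
rewrite qsample_preimage (independent_all indepT (fun i => measurable_quantize M_gt0
  D_gt0 (f i))).
by rewrite /prod_weight -prodEFin; apply: eq_bigr => i _; rewrite qlawE.
Qed.

Lemma qsample_prob (E : pred _) :
  P [set w | E (qsample w)] = (prod_prob qlaw E)%:E.
Proof.
rewrite (prob_finite_valued P measurable_qsample) -sumEFin.
by apply: eq_bigr => f _; rewrite qsample_weight.
Qed.

Local Notation dev f := (fun i => qval (f i) - fmean (qlaw i) qval).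

Lemma measurable_excess_entry i :
  measurable_fun setT (fun w => (excess M (T i w))%:E).
Proof.
by apply/measurable_EFinP; apply: measurableT_comp => //; exact: measurable_excess.
Qed.

Lemma measurable_qerr i : measurable_fun setT (fun w => T i w - M * qval (qentry i w)).
Proof.
apply: measurable_funB => //; apply: measurable_funM => //.
exact: (measurable_fun_finite_valued (measurable_qentry i)).
Qed.

Lemma integral_prob_cst (c : R) : (\int[P]_w c%:E = c%:E)%E.
Proof. by rewrite -[RHS](expectation_cst P) unlock. Qed.

Lemma integral_qerr i :
  (\int[P]_w (`|T i w - M * qval (qentry i w)|)%:E <=
   (M / D%:R)%:E + \int[P]_w (excess M (T i w))%:E)%E.
Proof.
apply: (@le_trans _ _ (\int[P]_w ((M / D%:R)%:E + (excess M (T i w))%:E))%E).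
  apply: le_integral_ge0 => w; first by rewrite lee_fin.
  by rewrite -EFinD lee_fin; exact: quantize_err.
rewrite ge0_integralD//.
- by rewrite integral_prob_cst.
- by move=> w _; rewrite lee_fin divr_ge0// ltW.
- by move=> w _; rewrite lee_fin excess_ge0.
- exact: measurable_excess_entry.
Qed.

Lemma mean_qerr i :
  (`|mean_tensor T i - M * fmean (qlaw i) qval|%:E <=
   (M / D%:R)%:E + \int[P]_w (excess M (T i w))%:E)%E.
Proof.
apply: le_trans (integral_qerr i).
have mq := measurable_fun_finite_valued (measurable_qentry i) (fun v => M * qval v).
have iq : (\int[P]_w (M * qval (qentry i w))%:E = (M * fmean (qlaw i) qval)%:E)%E.
  rewrite (integral_finite_valued P (measurable_qentry i) (fun v => M * qval v)).
  rewrite /fmean mulr_sumr -sumEFin; apply: eq_bigr => v _.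
  by rewrite -qlawE -EFinM; congr EFin; ring.
have intq : P.-integrable setT (EFin \o (fun w => M * qval (qentry i w))).
  apply: (le_integrable measurableT (g := EFin \o cst M)).
  - exact/measurable_EFinP.
  - move=> w _ /=; rewrite lee_fin normrM ler_piMr//; exact: gval_le1.
  - exact: finite_measure_integrable_cst.
have iT : (\int[P]_w (T i w)%:E = (mean_tensor T i)%:E)%E.
  rewrite /mean_tensor unlock fineK//.
  exact: (integrable_fin_num measurableT (intT i)).
have := le_abse_integral P measurableT (_ : measurable_fun setT (fun w => (T i w - M *
  qval (qentry i w))%:E)).
under eq_integral do rewrite EFinB.
rewrite integralB_EFin// iT iq -EFinB => h; apply: le_trans (h _) _.
  exact/measurable_EFinP/measurable_qerr.
by [].
Qed.

Lemma sum_cell : \sum_(i : tensor_index n r) M / D%:R = M / 2.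
Proof.
rewrite sumr_const card_ffun !card_ord -mulr_natl natrM invfM.
by field; rewrite pnatr_eq0 -lt0n expn_gt0 n_gt0.
Qed.

(** Rounding contributes [M / 2] and the excesses at most [M]. *)
Lemma sum_mean_qerr :
  \sum_i `|mean_tensor T i - M * fmean (qlaw i) qval| <= 3 / 2 * M.
Proof.
rewrite -lee_fin -sumEFin; apply: le_trans (lee_sum _ (fun i _ => mean_qerr i)) _.
rewrite big_split /= sumEFin sum_cell.
apply: le_trans (leeD2l _ (sum_excess M_gt0 indepT EM)) _.
by rewrite -EFinD lee_fin; lra.
Qed.

Lemma inj_norm_transfer w : inj_norm (centered T w) <=
  M * inj_norm (dev (qsample w)) + \sum_i `|T i w - M * qval (qentry i w)| + 3 / 2 * M.
Proof.
apply: le_trans (inj_norm_perturb n_gt0 (B := dev (qsample w)) (D := fun i =>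
  (T i w - M * qval (qentry i w)) - (mean_tensor T i - M * fmean (qlaw i) qval)) (ltW
    M_gt0) _) _.
  by move=> i; rewrite /centered /sample ffunE; ring.
rewrite -addrA lerD2l; apply: (@le_trans _ _ (\sum_i (`|T i w - M * qval (qentry i w)| +
   `|mean_tensor T i - M * fmean (qlaw i) qval|))).
  by apply: ler_sum => i _; exact: ler_normB.
by rewrite big_split /= lerD2l sum_mean_qerr.
Qed.

(** While the sup norm is at most [M] there is no excess, so sample and mean errors total at most
    [2 * M]. As [L * a >= 1], the [2] added to the constant absorbs them. *)
Lemma transfer_tail t : 0 < t ->
  (P [set w | ((400 * 33 + 2) * L * M * (Cconst n r eps + r%:R ^+ 3 * t / eps) <
               inj_norm (centered T w))%R] <=
   (n%:R `^ (- t))%:E + P [set w | (M < tensor_sup_norm (sample T w))%R])%E.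
Proof.
move=> t0; set a := Cconst n r eps + _.
pose E f := 400 * 33 * L * a < inj_norm (dev f).
have mE : measurable [set w | E (qsample w)] by exact: (measurable_finite_valued
  measurable_qsample E).
have mN : measurable [set w | M < tensor_sup_norm (sample T w)].
  exact: measurable_gt_set (measurable_sup_norm T).
apply: (@le_trans _ _ (P ([set w | E (qsample w)] `|` [set w | M < tensor_sup_norm
  (sample T w)]))).
  apply: le_measure; rewrite ?inE.
  - exact: measurable_inj_norm_gt.
  - exact: measurableU.
  move=> w /= hw; have [Nw|] := leP (tensor_sup_norm (sample T w)) M; [left|by right].
  have a1 : 1 <= a.
    have := Cconst_ge1 n_ge2 r_ge2 eps_gt0 eps_lt1.
    have : 0 <= r%:R ^+ 3 * t / eps by rewrite !mulr_ge0 ?invr_ge0 ?exprn_ge0// ltW.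
    by rewrite /a; lra.
  have La : 1 <= L * a by have := L_ge1; nra.
  have s2 : \sum_i `|T i w - M * qval (qentry i w)| <= M / 2.
    rewrite -sum_cell; apply: ler_sum => i _.
    have := quantize_err M_gt0 D_gt0 (T i w).
    by rewrite /excess ltNge (le_trans (le_sup_norm T w i) Nw) /= addr0.
  have h := lt_le_trans hw (inj_norm_transfer w).
  rewrite /E -(ltr_pM2l M_gt0); have M0 := M_gt0.
  have LaM : M <= L * a * M by nra.
  have -> : M * (400 * 33 * L * a) = 400 * 33 * (L * a * M) by ring.
  have hE : (400 * 33 + 2) * L * M * a = (400 * 33 + 2) * (L * a * M) by ring.
  rewrite hE in h; lra.
apply: le_trans (measureU2 P mE mN) _; apply: leeD => //.
apply: (@le_trans _ _ (prod_prob qlaw E)%:E); first by rewrite -(qsample_prob E).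
rewrite lee_fin.
exact: (finite_tail n_ge2 r_ge2 eps_gt0 eps_lt1 L_ge1 qlaw_ge0 qlaw_sum qlaw_sparse
  (gval_le1 D_gt0) t0).
Qed.

(** The sample error and the mean error each contribute [3 / 2 * M], absorbed by the [3] added to
    the constant. *)
Lemma transfer_mean :
  (\int[P]_w (inj_norm (centered T w))%:E <=
   ((3 * (400 * 33) + 3) * L * Cconst n r eps * M)%:E)%E.
Proof.
have mdev : measurable_fun setT (fun w => (inj_norm (dev (qsample w)))%:E).
  exact/measurable_EFinP/(measurable_fun_finite_valued measurable_qsample (fun f =>
    inj_norm (dev f))).
have merr i : measurable_fun setT (fun w => `|T i w - M * qval (qentry i w)|%:E).
  by apply/measurable_EFinP; apply: measurableT_comp => //; exact: measurable_qerr.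
have serr : (\int[P]_w (\sum_i `|T i w - M * qval (qentry i w)|%:E) <= (3 / 2 * M)%:E)%E.
  rewrite ge0_integral_sum//.
  apply: le_trans (lee_sum _ (fun i _ => integral_qerr i)) _.
  rewrite big_split /= sumEFin sum_cell.
  apply: le_trans (leeD2l _ (sum_excess M_gt0 indepT EM)) _.
  by rewrite -EFinD lee_fin; lra.
have idev : (\int[P]_w (inj_norm (dev (qsample w)))%:E =
    (\sum_f prod_weight qlaw f * inj_norm (dev f))%:E)%E.
  rewrite (integral_finite_valued P measurable_qsample (fun f => inj_norm (dev f))).
  by rewrite -sumEFin; apply: eq_bigr => f _; rewrite qsample_weight -EFinM mulrC.
apply: (@le_trans _ _ (\int[P]_w (M%:E * (inj_norm (dev (qsample w)))%:E +
   (\sum_i `|T i w - M * qval (qentry i w)|%:E + (3 / 2 * M)%:E)))%E).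
  apply: le_integral_ge0 => w; first by rewrite lee_fin inj_norm_ge0.
  rewrite sumEFin -EFinM -!EFinD lee_fin addrA; exact: inj_norm_transfer.
have M32 : 0 <= 3 / 2 * M by have := M_gt0; lra.
have sge0 w : (0 <= \sum_i `|T i w - M * qval (qentry i w)|%:E)%E.
  by rewrite sumEFin lee_fin sumr_ge0.
have ms : measurable_fun setT (fun w => \sum_i `|T i w - M * qval (qentry i w)|%:E)%E.
  exact: emeasurable_sum.
rewrite ge0_integralD//; first last.
- by apply: emeasurable_funD.
- by move=> w _; rewrite adde_ge0// lee_fin.
- exact: measurable_funeM.
- by move=> w _; rewrite mule_ge0// lee_fin ?inj_norm_ge0// ltW.
rewrite ge0_integralD//.
rewrite integral_prob_cst.
rewrite ge0_integralZl//; last 2 first.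
- by move=> w _; rewrite lee_fin inj_norm_ge0.
- by rewrite lee_fin ltW.
rewrite idev -EFinM.
apply: le_trans (leeD2l _ (leeD2r _ serr)) _.
rewrite -!EFinD lee_fin.
have fm := finite_mean n_ge2 r_ge2 eps_gt0 eps_lt1 L_ge1 qlaw_ge0 qlaw_sum qlaw_sparse
  (gval_le1 D_gt0).
apply: le_trans (lerD (ler_wpM2l (ltW M_gt0) fm) (lexx _)) _.
have C1 := Cconst_ge1 n_ge2 r_ge2 eps_gt0 eps_lt1.
have M0 := M_gt0; have L1 := L_ge1.
have LC : 1 <= L * Cconst n r eps by nra.
have LCM : M <= L * Cconst n r eps * M by nra.
lra.
Qed.

End Transfer.

(** * Finiteness of the mean sup norm, and the case where it vanishes *)

Section DegenerateScale.
Context {d : measure_display} {Omega : measurableType d} {R : realType}.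
Variable P : probability Omega R.
Context (n r : nat) (T : tensor_index n r -> {RV P >-> R}).
Hypothesis n_gt0 : (0 < n)%N.
Hypothesis intT : forall i, P.-integrable [set: Omega] (EFin \o T i).

Local Notation N w := (tensor_sup_norm (sample T w)).

Lemma integral_sup_norm_fin : (\int[P]_w (N w)%:E)%E \is a fin_num.
Proof.
rewrite ge0_fin_numE; last by apply: integral_ge0 => w _; rewrite lee_fin sup_norm_ge0.
apply: (@le_lt_trans _ _ (\int[P]_w (\sum_i `|T i w|%:E))%E).
  apply: le_integral_ge0 => w; first by rewrite lee_fin sup_norm_ge0.
  by rewrite sumEFin lee_fin sup_norm_le_sum.
rewrite ge0_integral_sum//; last first.
  by move=> i; apply/measurable_EFinP; apply: measurableT_comp.
by apply: lte_sum_pinfty => i _; case/integrableP: (intT i).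
Qed.

Lemma mean_le_sup_norm i : (`|mean_tensor T i|%:E <= \int[P]_w (N w)%:E)%E.
Proof.
have iT : (\int[P]_w (T i w)%:E = (mean_tensor T i)%:E)%E.
  rewrite /mean_tensor unlock fineK//.
  exact: (integrable_fin_num measurableT (intT i)).
have mT : measurable_fun setT (fun w => (T i w)%:E) by exact/measurable_EFinP.
rewrite -[leLHS]/(`|(mean_tensor T i)%:E|%E) -iT.
apply: le_trans (le_abse_integral P measurableT mT) _.
apply: le_integral_ge0 => w //; rewrite lee_fin; exact: le_sup_norm.
Qed.

(** If the mean sup norm vanishes, so do all entry means, and centering changes nothing. *)
Lemma inj_norm_gt0_sub : (\int[P]_w (N w)%:E <= 0)%E ->
  [set w | 0 < inj_norm (centered T w)] `<=` [set w | 0 < N w].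
Proof.
move=> N0 w /= inj0; rewrite lt_neqAle sup_norm_ge0 andbT eq_sym.
apply: contraTneq inj0 => Nw; rewrite -leNgt; apply: inj_norm_le => // x _.
rewrite /tensor_dot big1 ?normr0// => i _; rewrite /centered /sample.
have -> : T i w = 0 by apply/eqP; rewrite -normr_le0 -Nw le_sup_norm.
have -> : mean_tensor T i = 0.
  apply/eqP; rewrite -normr_le0 -lee_fin; apply: le_trans N0; exact: mean_le_sup_norm.
by rewrite subr0 mul0r.
Qed.

End DegenerateScale.

Theorem corollary4p3 (R : realType) :
  exists C0 : R, 0 < C0 /\
  forall (n r : nat) (eps L : R)
    (d : measure_display) (Omega : measurableType d) (P : probability Omega R)
    (T : tensor_index n r -> {RV P >-> R}),
    (2 <= n)%N -> (2 <= r)%N -> 0 < eps -> eps < 1 -> 1 <= L ->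
    mutually_independent T ->
    (forall i, P.-integrable [set: Omega] (EFin \o T i)) ->
    (forall i, (P [set w | T i w <> 0%R] <= (L * n%:R `^ (- 1 - eps))%:E)%E) ->
    ('E_P[fun w => inj_norm (centered T w)] <=
       (C0 * Cconst n r eps * L)%:E *
       'E_P[fun w => tensor_sup_norm (sample T w)])%E /\
    (forall t M : R, 0 < t ->
       (2%:E * 'E_P[fun w => tensor_sup_norm (sample T w)] <= M%:E)%E ->
       (P [set w | (C0 * L * M * (Cconst n r eps + r%:R ^+ 3 * t / eps) <
                    inj_norm (centered T w))%R] <=
        (n%:R `^ (- t))%:E +
        P [set w | (M < tensor_sup_norm (sample T w))%R])%E).
Proof.
(* The factor [2] comes from applying [transfer_mean] with [M] close to twice the mean sup norm; the
   result also exceeds the constant of [transfer_tail]. *)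
pose C0 : R := 2 * (3 * (400 * 33) + 3).
exists C0; split; first by rewrite /C0; lra.
move=> n r eps L d Omega P T n2 r2 eps0 eps1 L1 indepT intT sparseT.
rewrite unlock.
have n0 : (0 < n)%N by exact: ltnW.
have C1 := Cconst_ge1 n2 r2 eps0 eps1.
have Nfin := integral_sup_norm_fin intT.
have N0 : (0 <= \int[P]_w (tensor_sup_norm (sample T w))%:E)%E.
  by apply: integral_ge0 => w _; rewrite lee_fin sup_norm_ge0.
move EE : (\int[P]_w (tensor_sup_norm (sample T w))%:E)%E Nfin N0 => e' Nfin.
rewrite -(fineK Nfin) lee_fin; move EE' : (fine e') => e e0.
have {EE' Nfin}EE : (\int[P]_w (tensor_sup_norm (sample T w))%:E)%E = e%:E.
  by rewrite EE -(fineK Nfin) EE'.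
split.
  (* [transfer_mean] requires a positive scale while [e] may be [0]. The added [dl / K] costs
     exactly [dl], which is arbitrary. *)
  apply/lee_addgt0Pr => dl dl0.
  pose K := (3 * (400 * 33) + 3) * L * Cconst n r eps.
  have K0 : 0 < K by rewrite /K !mulr_gt0//; lra.
  have M0 : 0 < 2 * e + dl / K by rewrite ltr_wpDl ?mulr_ge0// divr_gt0.
  have EM : (2%:E * \int[P]_w (tensor_sup_norm (sample T w))%:E <= (2 * e + dl / K)%:E)%E.
    by rewrite EE -EFinM lee_fin lerDl divr_ge0 ?ltW.
  apply: le_trans (transfer_mean n2 r2 eps0 eps1 L1 indepT intT sparseT M0 EM) _.
  rewrite -EFinM -EFinD lee_fin -/K.
  have -> : K * (2 * e + dl / K) = K * (2 * e) + dl by field; rewrite gt_eqF.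
  by rewrite /C0 /K; lra.
move=> t M t0; rewrite -EFinM lee_fin => eM.
have M0 : 0 <= M by lra.
have a0 : 0 <= Cconst n r eps + r%:R ^+ 3 * t / eps.
  by rewrite addr_ge0 ?mulr_ge0 ?invr_ge0 ?exprn_ge0 ?(ltW t0) ?(ltW eps0)//; lra.
(* [M = 0] forces [e = 0]. Both thresholds are then [0] and the events are compared directly. *)
have [M00|Mp] := eqVneq M 0.
  rewrite M00 mulr0 mul0r; apply: (@le_trans _ _ (P [set w | 0 < tensor_sup_norm
    (sample T w)])).
    apply: le_measure; rewrite ?inE.
    - exact: measurable_inj_norm_gt.
    - exact: measurable_gt_set (measurable_sup_norm T).
    by apply: inj_norm_gt0_sub => //; rewrite EE lee_fin; lra.
  by rewrite leeDr// lee_fin powR_ge0.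
have Mgt : 0 < M by rewrite lt_neqAle eq_sym Mp.
have EM : (2%:E * \int[P]_w (tensor_sup_norm (sample T w))%:E <= M%:E)%E.
  by rewrite EE -EFinM lee_fin.
apply: le_trans (transfer_tail n2 r2 eps0 eps1 L1 indepT intT sparseT Mgt EM t0).
apply: le_measure; rewrite ?inE; [exact: measurable_inj_norm_gt|exact:
  measurable_inj_norm_gt|].
move=> w /=; apply: le_lt_trans; do 3 apply: ler_wpM2r => //; first by lra.
by rewrite /C0; lra.
Qed.
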